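(* Let $\Omega$ be a bounded domain in $\mathbb C^n$ and $F\subset\partial\Omega$ be a non-empty closed set satisfying the following properties: (1) $\partial\Omega\setminus F$ is locally pseudoconvex; (2) there exist a pseudoconvex open neighborhood $U$ of $F$ in $\mathbb C^n$ and a continuous plurisubharmonic function $v$ on $U\cap\Omega$ such that $$F=\{z\in\partial\Omega:\lim_{\xi\to z}v(\xi)=+\infty\}.$$ Then $\Omega$ is pseudoconvex.
   Context: ''$\partial\Omega\setminus F$ is locally pseudoconvex'' means: for any $\zeta\in\partial\Omega\setminus F$ there exists $r>0$ such that $B(\zeta,r)\cap\Omega$ is pseudoconvex, where $B(\zeta,r)$ is the open Euclidean ball. The limit in (2) is taken over $\xi\in U\cap\Omega$. *)

(* Defs.v *)
(* R : realType plays the role of the real numbers, R[i] of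
   the complex numbers, and row vectors 'rV[R[i]]_n of C^n. *)
From HB Require Import structures.
From mathcomp Require Import all_boot all_order all_algebra.
From mathcomp Require Import complex.
From mathcomp Require Import all_classical all_reals all_analysis.

Set Implicit Arguments.
Unset Strict Implicit.
Unset Printing Implicit Defensive.

Import Order.TTheory GRing.Theory Num.Theory.
Import numFieldNormedType.Exports.

Local Open Scope classical_set_scope.
Local Open Scope ring_scope.

(* The topology and norm of R[i] are those that every numFieldType carries, i.e.
   those given by the complex modulus; 'rV[R[i]]_n then gets the product topology
   and the sup norm from the library. *)
HB.instance Definition _ (R : rcfType) :=
  NormedModule.copy R[i] (R[i] : numFieldType)^o.

Definition boundary (T : topologicalType) (A : set T) : set T :=
  closure A `\` interior A.

Definition is_domain (T : topologicalType) (A : set T) : Prop :=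
  [/\ open A, A !=set0 & connected A].

(* The library's [ball] on 'rV[R[i]]_n is a polydisc. *)
Definition euclidean_ball (R : realType) (n : nat)
    (z : 'rV[R[i]]_n) (r : R) : set 'rV[R[i]]_n :=
  [set y | \sum_(i < n) `|y 0 i - z 0 i| ^+ 2 < (r%:C)%C ^+ 2].

Definition usc_on (R : realType) (T : topologicalType)
    (A : set T) (u : T -> \bar R) : Prop :=
  forall x, A x -> forall a : R, (u x < a%:E)%E ->
    \forall y \near within A (nbhs x), (u y < a%:E)%E.

Definition circle_mean (R : realType) (u : R[i] -> \bar R)
    (a : R[i]) (r : R) : \bar R :=
  (((2 * pi)^-1)%:E *
   \int[lebesgue_measure]_(t in `[0%R, (2 * pi)%R])
     u (a + (r%:C)%C * (cos t +i* sin t)%C)%R)%E.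

(* Subharmonic functions take values in [-oo, +oo[, and -oo identically is
   allowed; only the values of u on D matter. *)
Definition subharmonic (R : realType) (D : set R[i]) (u : R[i] -> \bar R)
    : Prop :=
  [/\ forall a, D a -> (u a < +oo)%E,
      usc_on D u
    & forall (a : R[i]) (r : R), 0 < r ->
        [set y : R[i] | `|y - a| <= (r%:C)%C] `<=` D ->
        (u a <= circle_mean u a r)%E].

Definition plurisubharmonic (R : realType) (n : nat)
    (A : set 'rV[R[i]]_n) (u : 'rV[R[i]]_n -> \bar R) : Prop :=
  [/\ forall z, A z -> (u z < +oo)%E,
      usc_on A u
    & forall z w : 'rV[R[i]]_n, A z ->
        subharmonic [set t : R[i] | A (z + t *: w)]
                    (fun t => u (z + t *: w))].

Definition continuous_psh (R : realType) (n : nat)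
    (A : set 'rV[R[i]]_n) (u : 'rV[R[i]]_n -> R) : Prop :=
  {within A, continuous u} /\ plurisubharmonic A (EFin \o u).

(* Each sublevel set is relatively compact in A: its closure in C^n is compact
   and contained in A. *)
Definition exhaustion (R : realType) (n : nat)
    (A : set 'rV[R[i]]_n) (u : 'rV[R[i]]_n -> R) : Prop :=
  forall c : R,
    precompact [set z | A z /\ u z < c] /\
    closure [set z | A z /\ u z < c] `<=` A.

Definition pseudoconvex (R : realType) (n : nat) (A : set 'rV[R[i]]_n) : Prop :=
  open A /\ exists u : 'rV[R[i]]_n -> R, continuous_psh A u /\ exhaustion A u.

Definition locally_pseudoconvex_off (R : realType) (n : nat)
    (Omega F : set 'rV[R[i]]_n) : Prop :=
  forall zeta, (boundary Omega `\` F) zeta ->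
    exists2 r : R, 0 < r & pseudoconvex (euclidean_ball zeta r `&` Omega).

(* The limit of v at z along A is +oo.  Without [closure A z] the filter of
   traces on A could be improper and the second conjunct would hold vacuously. *)
Definition tends_to_pinfty_along (R : realType) (T : topologicalType)
    (A : set T) (v : T -> R) (z : T) : Prop :=
  closure A z /\ (v y @[y --> within A (nbhs z)] --> +oo).

(* Main.v *)
(* Idea.  A bounded open set whose boundary points have neighbourhoods W such
   that W & E satisfies a continuity principle for holomorphic discs (the
   [disc_property] below) is pseudoconvex: near the boundary 1 / codist is
   plurisubharmonic, and max (1 / codist) C is an exhaustion (codist is the
   distance to the complement).  Conversely pseudoconvex sets have the disc
   property, by the maximum principle for the exhaustion on discs and
   connectedness in the homotopy parameter.  Now U & Omega has the disc
   property: it is the increasing union of the sets {v < j}, which avoid a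
   neighbourhood of F and hence are locally, so globally, pseudoconvex.  Since
   the closed set F lies in U, every boundary point of Omega then has a
   neighbourhood on which Omega has the disc property.

   Plurisubharmonicity is tested on complex lines only, and no regularization by
   convolution is used: the circle integrals are replaced by means over the N-th
   roots of unity, N -> oo ([dsub]); the maximum principle on a curved disc is
   obtained by penalization from the submean property on lines
   ([jet_max_principle]); and the Dirichlet problem is replaced by Fejer's
   trigonometric polynomials ([fejer_majorant]). *)
Require Import Defs.
From HB Require Import structures.
From mathcomp Require Import all_boot all_order all_algebra.
From mathcomp Require Import complex.
From mathcomp Require Import all_classical all_reals all_analysis.
From mathcomp Require Import zify ring lra.
Set Implicit Arguments.
Unset Strict Implicit.
Unset Printing Implicit Defensive.
Import Order.TTheory GRing.Theory Num.Theory.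
Import numFieldNormedType.Exports.
Local Open Scope classical_set_scope.
Local Open Scope ring_scope.

Local Notation Re := (@complex.Re _).
Local Notation Im := (@complex.Im _).

(** * Real-valued norm on complex normed spaces *)

Section RealNorm.
Variable R : realType.
Implicit Types V : normedModType R[i].

(** Norms over [R[i]] are complex numbers with vanishing imaginary part; their real part lives in
    the ordered field [R], where real order and arithmetic apply. *)
Definition nrm V (x : V) : R := Re `|x|.

Lemma nrmE V (x : V) : `|x| = (nrm x)%:C%C.
Proof. by rewrite /nrm RRe_real // ger0_real. Qed.

Lemma nrm_ge0 V (x : V) : 0 <= nrm x.
Proof. by rewrite -ler0c -nrmE. Qed.

Lemma nrm0 V : nrm (0 : V) = 0.
Proof. by rewrite /nrm normr0. Qed.

Lemma nrm_eq0 V (x : V) : (nrm x == 0) = (x == 0).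
Proof. by rewrite -[RHS]normr_eq0 nrmE eq_complex /= eqxx andbT. Qed.

Lemma nrmD V (x y : V) : nrm (x + y) <= nrm x + nrm y.
Proof.
by rewrite -lecR; have := ler_normD x y; rewrite !nrmE -rmorphD.
Qed.

Lemma nrmN V (x : V) : nrm (- x) = nrm x.
Proof. by rewrite /nrm normrN. Qed.

Lemma nrmBC V (x y : V) : nrm (x - y) = nrm (y - x).
Proof. by rewrite -nrmN opprB. Qed.

Lemma nrmZ V (a : R[i]) (x : V) : nrm (a *: x) = nrm a * nrm x.
Proof. by apply: complexI; rewrite -nrmE normrZ !nrmE -rmorphM. Qed.

Lemma nrmM (a b : R[i]) : nrm (a * b) = nrm a * nrm b.
Proof. exact: nrmZ. Qed.

Lemma nrm1 : nrm (1 : R[i]) = 1.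
Proof. by rewrite /nrm normr1. Qed.

Lemma nrmX (a : R[i]) m : nrm (a ^+ m) = nrm a ^+ m.
Proof. by elim: m => [|m IH]; rewrite ?expr0 ?nrm1 // !exprS nrmM IH. Qed.

Lemma nrmV (a : R[i]) : nrm a^-1 = (nrm a)^-1.
Proof. by apply: complexI; rewrite -nrmE normfV nrmE fmorphV. Qed.

Lemma nrm_real (x : R) : nrm (x%:C%C : R[i]) = `|x|.
Proof. by rewrite /nrm normc_def /= expr0n addr0 sqrtr_sqr. Qed.

Lemma nrm_sqr (a : R[i]) : nrm a ^+ 2 = Re a ^+ 2 + Im a ^+ 2.
Proof. by rewrite /nrm normc_def /= sqr_sqrtr // addr_ge0 ?sqr_ge0. Qed.

Lemma ler_Re_nrm (a : R[i]) : `|Re a| <= nrm a.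
Proof. by rewrite -lecR -nrmE normc_ge_Re. Qed.

Lemma ler_Im_nrm (a : R[i]) : `|Im a| <= nrm a.
Proof.
have -> : Im a = - Re (a * 'i%C) by rewrite ReiNIm opprK.
rewrite normrN (le_trans (ler_Re_nrm _)) // nrmM.
by rewrite /nrm normc_def /= expr0n expr1n add0r sqrtr1 mulr1.
Qed.

Lemma nrm_sum V (I : Type) (r : seq I) (P : pred I) (F : I -> V) :
  nrm (\sum_(i <- r | P i) F i) <= \sum_(i <- r | P i) nrm (F i).
Proof.
elim/big_rec2: _ => [|i y1 y2 _ h]; first by rewrite nrm0.
by rewrite (le_trans (nrmD _ _)) // lerD2l.
Qed.

Lemma nrm_triangle V (x y z : V) : nrm (x - z) <= nrm (x - y) + nrm (y - z).
Proof. by rewrite (le_trans _ (nrmD _ _)) // addrA subrK. Qed.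

Lemma nrm_dist V (x y : V) : `|nrm x - nrm y| <= nrm (x - y).
Proof.
have le_sub (a b : V) : nrm a - nrm b <= nrm (a - b).
  by rewrite lerBlDr (le_trans _ (nrmD _ _)) // subrK.
by rewrite ler_norml le_sub andbT lerNl opprB nrmBC le_sub.
Qed.

Lemma posC (e : R[i]) : 0 < e -> exists2 r : R, 0 < r & e = r%:C%C.
Proof.
move=> e0; exists (Re e); last by rewrite RRe_real // gtr0_real.
by move: e0; rewrite ltcE /= => /andP[].
Qed.

Lemma nbhs_nrmP V (x : V) (P : set V) :
  nbhs x P <-> exists2 e : R, 0 < e & forall y, nrm (y - x) < e -> P y.
Proof.
rewrite -nbhs_ballE /=; split => [[e /= /posC[r r0 ->]] h|[e e0 h]].
  exists r => // y hy; apply: h; rewrite -ball_normE /= distrC nrmE ltcR.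
  exact: hy.
exists (e%:C%C) => /=; first by rewrite ltcR.
by move=> y; rewrite -ball_normE /= distrC nrmE ltcR; exact: h.
Qed.

Lemma nrm_continuous V : continuous (@nrm V).
Proof.
move=> x; apply/cvgrPdist_lt => e e0; apply/nbhs_nrmP; exists e => // y hy.
by rewrite (le_lt_trans (nrm_dist _ _)) // nrmBC.
Qed.

Lemma Re_continuous : continuous (Re : R[i] -> R).
Proof.
move=> x; apply/(@cvgrPdist_lt _ _ _ _ (nbhs_filter x)) => e e0.
apply/(@nbhs_nrmP R[i]); exists e => // y hy.
by rewrite -raddfB (le_lt_trans (ler_Re_nrm _)) // nrmBC.
Qed.

Lemma cvg_nrmP V (T : Type) (F : set_system T) (FF : Filter F) (f : T -> V) (y : V) :
  f @ F --> y <-> forall e : R, 0 < e -> \forall x \near F, nrm (f x - y) < e.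
Proof.
split=> [/cvgrPdist_lt h e e0|h].
  have /h : 0 < (e%:C%C : R[i]) by rewrite ltcR.
  by apply: filterS => x; rewrite distrC nrmE ltcR.
apply/cvgrPdist_lt => e /posC[r r0 ->]; apply: filterS (h r r0) => x.
by rewrite distrC nrmE ltcR.
Qed.

Lemma real_complex_continuous : continuous (real_complex R).
Proof.
move=> x; apply/(@cvg_nrmP R[i] _ _ (nbhs_filter x)) => e e0.
have hx := nbhsx_ballx x e e0.
apply: (@filterS _ (nbhs x) (nbhs_filter x) _ _ _ hx) => y.
by rewrite -rmorphB nrm_real distrC.
Qed.

Lemma complex_of_prod_continuous :
  continuous (fun p : R * R => (p.1 +i* p.2)%C : R[i]).
Proof.
have -> : (fun p : R * R => (p.1 +i* p.2)%C : R[i]) =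
    (fun p => p.1%:C%C + 'i%C * p.2%:C%C) by apply/funext => p; rewrite [LHS]complexE.
move=> p; apply: cvgD.
  apply: (cvg_comp _ _ (@cvg_fst _ _ (nbhs p.1) (nbhs p.2) _)).
  exact: real_complex_continuous.
apply: cvgM; first exact: cvg_cst.
apply: (cvg_comp _ _ (@cvg_snd _ _ (nbhs p.1) (nbhs p.2) _)).
exact: real_complex_continuous.
Qed.

Lemma closed_nrm_le V (r : R) : closed [set x : V | nrm x <= r].
Proof.
apply: (@closed_comp _ _ (@nrm V) [set y | y <= r]); last exact: closed_le.
by move=> x _; exact: nrm_continuous.
Qed.

Lemma compact_disc (r : R) : compact [set t : R[i] | nrm t <= r].
Proof.
apply: (@subclosed_compact _ _
   ((fun p : R * R => (p.1 +i* p.2)%C : R[i]) @` (`[-r, r] `*` `[-r, r]))).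
- exact: closed_nrm_le.
- apply: continuous_compact.
    exact/continuous_subspaceT/complex_of_prod_continuous.
  by apply: compact_setX; exact: segment_compact.
- move=> t /= ht; exists (Re t, Im t) => /=; last by case: t {ht}.
  by split; rewrite /= in_itv /= -ler_norml (le_trans _ ht) // ?ler_Re_nrm ?ler_Im_nrm.
Qed.

Lemma compact_circle : compact [set t : R[i] | nrm t = 1].
Proof.
apply: (subclosed_compact _ (@compact_disc 1)); last by move=> t /= ->.
apply: (@closed_comp _ _ (@nrm R[i]) [set y | y = 1]); last exact: closed_eq.
by move=> x _; exact: nrm_continuous.
Qed.

Lemma nrm_coord n (x : 'rV[R[i]]_n) (i : 'I_n) : nrm (x 0 i) <= nrm x.
Proof.
rewrite -lecR -!nrmE [leRHS]/Num.norm /= mx_normE.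
change (`|x 0 i|) with ((`|x 0 i|%:nng)%:num); rewrite num_le.
by apply/bigmax_geP; right => /=; exists (0, i).
Qed.

Lemma compact_rV_ball n (r : R) : compact [set x : 'rV[R[i]]_n | nrm x <= r].
Proof.
apply: (@subclosed_compact _ _
   [set v : 'rV[R[i]]_n | forall i, [set t | nrm t <= r] (v ord0 i)]).
- exact: closed_nrm_le.
- by apply: (@rV_compact _ _ (fun=> [set t : R[i] | nrm t <= r])) => i; exact: compact_disc.
- by move=> x /= hx i; rewrite (le_trans (nrm_coord _ _)).
Qed.

End RealNorm.

(** * Circle means as limits of means over roots of unity *)

(** Tube lemma in filter form: local uniformity at each point of a compact set gives uniformity on
    the whole set. *)
Lemma compact_near_forall (X : topologicalType) (K : set X) (I : Type)
    (F : set_system I) (FF : Filter F) (P : I -> X -> Prop) :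
  compact K ->
  (forall x, K x -> exists2 A, nbhs x A &
     exists2 B, F B & forall y i, A y -> B i -> P i y) ->
  \forall i \near F, forall x, K x -> P i x.
Proof.
move=> /compact_near_coveringP cK h; apply: cK => x Kx.
have [A nA [B FB AB]] := h x Kx.
by exists (A, B) => // -[y i] /= [Ay Bi]; exact: AB.
Qed.

Section CircleMeans.
Variable R : realType.

Definition cis (t : R) : R[i] := (cos t +i* sin t)%C.

Lemma cisD a b : cis (a + b) = cis a * cis b.
Proof. by rewrite /cis cosD sinD; congr (_ +i* _)%C; rewrite addrC mulrC. Qed.

Lemma cis0 : cis 0 = 1.
Proof. by rewrite /cis cos0 sin0. Qed.

Lemma cisX t m : cis t ^+ m = cis (m%:R * t).
Proof.
elim: m => [|m IH]; first by rewrite mul0r cis0.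
by rewrite exprS IH -cisD -{1}[t]mul1r -mulrDl -nat1r.
Qed.

Lemma nrm_cis t : nrm (cis t) = 1.
Proof. by rewrite /nrm normc_def /= cos2Dsin2 sqrtr1. Qed.

Lemma cis_continuous : continuous cis.
Proof.
move=> t; apply: (@continuous_comp _ _ _ (fun t => (cos t, sin t))
  (fun p : R * R => (p.1 +i* p.2)%C : R[i])).
  exact: (cvg_pair (@continuous_cos R t) (@continuous_sin R t)).
exact: complex_of_prod_continuous.
Qed.

Definition omega (N : nat) : R[i] := cis (2 * pi / N%:R).

Lemma nrm_omega N : nrm (omega N) = 1.
Proof. exact: nrm_cis. Qed.

Lemma omegaX N : (0 < N)%N -> omega N ^+ N = 1.
Proof.
move=> N0; rewrite cisX mulrC divfK ?pnatr_eq0 -?lt0n //.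
by rewrite mulr_natl /cis cos2pi sin2pi.
Qed.

Lemma omegaX_neq1 N j : (0 < j < N)%N -> omega N ^+ j != 1.
Proof.
move=> /andP[j0 jN]; have N0 : (0 < N)%N by exact: leq_trans jN.
(* Half the angle of [omega N ^+ j]: it lies strictly between 0 and pi, so [sin x > 0] excludes both
   square roots 1 and -1 of 1. *)
pose x : R := j%:R * (pi / N%:R).
have x0 : 0 < sin x.
  apply: sin_gt0_pi; rewrite /x mulr_gt0 ?divr_gt0 ?ltr0n ?pi_gt0 //=.
  by rewrite mulrCA gtr_pMr ?pi_gt0 // ltr_pdivrMr ?ltr0n // mul1r ltr_nat.
have -> : omega N ^+ j = cis x ^+ 2.
  by rewrite !cisX; congr cis; rewrite /x; ring.
rewrite -subr_eq0 subr_sqr_1 mulf_eq0 negb_or; apply/andP; split.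
  by rewrite subr_eq0 eq_complex /= (gt_eqF x0) andbF.
by rewrite addr_eq0 eq_complex /= oppr0 (gt_eqF x0) andbF.
Qed.

Lemma sum_omegaX N j : (0 < j < N)%N -> \sum_(m < N) omega N ^+ (m * j) = 0.
Proof.
move=> jN; have N0 : (0 < N)%N by case/andP: jN => _; exact: leq_ltn_trans.
have /eqP : (omega N ^+ j - 1) * \sum_(m < N) omega N ^+ (m * j) = 0.
  under eq_bigr do rewrite mulnC exprM.
  by rewrite -subrX1 -exprM mulnC exprM omegaX // expr1n subrr.
by rewrite mulf_eq0 subr_eq0 (negbTE (omegaX_neq1 jN)) => /eqP.
Qed.

Definition dmean (N : nat) (g : R[i] -> R) : R :=
  N%:R^-1 * \sum_(m < N) g (omega N ^+ m).

(** Submean inequality at 0 for the unit circle: [g 0] is at most the lower limit of the means over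
    the N-th roots of unity. It makes sense without any integrability of [g]. *)
Definition dsub (g : R[i] -> R) : Prop :=
  forall e : R, 0 < e -> \forall N \near \oo, g 0 <= dmean N g + e.

Lemma continuous_primitive (f : R -> R) (b : R) : 0 < b -> continuous f ->
  exists F : R -> R, (forall x, 0 <= x <= b -> is_derive x 1 F (f x)) /\
    (\int[lebesgue_measure]_(x in `[0%R, b]) (f x)%:E = (F b - F 0)%:E)%E.
Proof.
move=> b0 cf.
(* Integrating from -1 rather than 0 makes [F] differentiable from both sides at 0 as well. *)
pose F x : R := (\int[lebesgue_measure]_(t in [set` Interval (BLeft (-1)) (BRight x)]) f t)%R.
have dF x : 0 <= x <= b -> is_derive x 1 F (f x).
  move=> /andP[x0 xb].
  have xb1 : x < b + 1 by rewrite (le_lt_trans xb) // ltrDl.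
  have [|||d1 d2] := @continuous_FTC1 R f (BLeft (-1)) x (b + 1) xb1.
  - apply: continuous_compact_integrable; first exact: segment_compact.
    exact: continuous_subspaceT.
  - by rewrite lte_fin; lra.
  - exact: cf.
  by move: d2; rewrite derive1E => d2; exact: (DeriveDef d1 d2).
exists F; split=> //.
have cF x : 0 <= x <= b -> {for x, continuous F}.
  by move=> /dF[d _]; apply/differentiable_continuous/derivable1_diffP.
have h0 : {for 0, continuous F} by apply: cF; rewrite lexx ltW.
have hb : {for b, continuous F} by apply: cF; rewrite lexx ltW.
rewrite (@continuous_FTC2 R f F 0 b) //.
- exact: continuous_subspaceT.
- split.
  + by move=> x; rewrite in_itv/= => /andP[/ltW x0 /ltW xb]; case: (dF x) => //; rewrite x0.
  + exact: cvg_at_right_filter.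
  + exact: cvg_at_left_filter.
- move=> x; rewrite in_itv/= => /andP[/ltW x0 /ltW xb].
  by rewrite derive1E; case: (dF x) => //; rewrite x0.
Qed.

(** The integral is a telescoping sum of increments of a primitive. By the mean value theorem each
    increment is [h * f c] with c in the subinterval, and uniform continuity bounds each error by
    [h * (e / b) = e / N]. *)
Lemma riemann_sum_cvg (f : R -> R) (b I : R) : 0 < b -> continuous f ->
  (\int[lebesgue_measure]_(x in `[0%R, b]) (f x)%:E = I%:E)%E ->
  forall e, 0 < e -> \forall N \near \oo,
    `|I - b / N%:R * \sum_(m < N) f (m%:R * (b / N%:R))| <= e.
Proof.
move=> b0 cf hI e e0.
have [F [dF /esym]] := continuous_primitive b0 cf; rewrite hI => -[<-].
have unif : \forall N \near \oo, forall x, `[0, b]%classic x ->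
    forall y, `|y - x| <= b / N%:R -> `|f y - f x| <= e / b.
  apply: compact_near_forall; first exact: segment_compact.
  move=> x _.
  have eb : 0 < e / b / 2 by rewrite !divr_gt0.
  have := cf x; move=> /cvgrPdist_lt /(_ _ eb) /nbhs_ballP[d /= d0 hd].
  have d2 : 0 < d / 2 by rewrite divr_gt0.
  exists (ball x (d / 2)); first exact: nbhsx_ballx.
  exists [set N : nat | b / N%:R < d / 2].
    near=> N => /=; have N0 : (0 : R) < N%:R by near: N; exact: nbhs_infty_gtr.
    rewrite ltr_pdivrMr // mulrC -ltr_pdivrMr //; near: N; exact: nbhs_infty_gtr.
  move=> y N xy hN z yz.
  have xy' : `|x - y| < d / 2 := xy.
  have hN' : b / N%:R < d / 2 := hN.
  have h1 : `|f x - f y| < e / b / 2 by apply: hd; rewrite /ball /=; lra.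
  have h2 : `|f x - f z| < e / b / 2.
    apply: hd; rewrite /ball /=; have := ler_distD y x z.
    by rewrite (distrC y z); lra.
  have := ler_distD (f x) (f z) (f y); rewrite (distrC (f z) (f x)); lra.
near=> N.
have N0 : (0 < N)%N by near: N; exact: nbhs_infty_gt.
have N0' : (0 : R) < N%:R by rewrite ltr0n.
pose h := b / N%:R; have h0 : 0 < h by rewrite divr_gt0.
have hN : N%:R * h = b by rewrite mulrC divfK ?gt_eqF.
pose x m : R := m%:R * h.
have mvt m : (m < N)%N -> `|F (x m.+1) - F (x m) - h * f (x m)| <= e / N%:R.
  move=> mN; have xx : x m.+1 - x m = h by rewrite /x -natr1 mulrDl mul1r addrAC subrr add0r.
  have xm : x m < x m.+1 by rewrite -subr_gt0 xx.
  have xm0 : 0 <= x m by rewrite mulr_ge0 // ltW.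
  have xmb : x m.+1 <= b by rewrite -hN ler_pM2r // ler_nat.
  have dF' c : x m <= c <= x m.+1 -> is_derive c 1 F (f c).
    by move=> /andP[c1 c2]; apply: dF; rewrite (le_trans xm0 c1) (le_trans c2).
  have [||c] := @MVT R F f _ _ xm.
  - by move=> c; rewrite in_itv /= => /andP[/ltW c1 /ltW c2]; apply: dF'; rewrite c1.
  - apply: derivable_within_continuous => c; rewrite in_itv /= => hc.
    by case: (dF' c hc).
  rewrite in_itv /= xx => /andP[c1 c2] ->.
  rewrite mulrC -mulrBr normrM gtr0_norm //.
  have -> : e / N%:R = h * (e / b) by rewrite /h; field; rewrite !gt_eqF.
  rewrite ler_pM2l //.
  have := near unif N => -> //; first by rewrite /= in_itv /= xm0; lra.
  by rewrite -/h ger0_norm; lra.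
have -> : F b - F 0 = \sum_(m < N) (F (x m.+1) - F (x m)).
  rewrite -(big_mkord xpredT (fun m => F (x m.+1) - F (x m))) telescope_sumr //.
  by rewrite /x hN mul0r.
rewrite -/h mulr_sumr -sumrB (le_trans (ler_norm_sum _ _ _)) //.
apply: (@le_trans _ _ (\sum_(m < N) e / N%:R)); first by apply: ler_sum => m _; apply: mvt.
by rewrite sumr_const card_ord -[leLHS]mulr_natr divfK ?gt_eqF.
Unshelve. all: by end_near. Qed.

(** The bridge between integrals and [dsub]: the mean over the roots of unity is a left Riemann sum
    of the circle integral. *)
Lemma circle_mean_dmean (u : R[i] -> \bar R) (g : R[i] -> R) (a : R[i]) (r : R) :
  (forall t, u (a + (r%:C)%C * cis t) = (g (cis t))%:E) ->
  continuous (g \o cis) ->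
  exists2 I : R, circle_mean u a r = I%:E &
    forall e, 0 < e -> \forall N \near \oo, `|I - dmean N g| <= e.
Proof.
move=> ug cg.
have p2 : 0 < 2 * pi :> R by rewrite mulr_gt0 // pi_gt0.
have [F [_ hF]] := continuous_primitive p2 cg.
exists ((2 * pi)^-1 * (F (2 * pi) - F 0)).
  rewrite /circle_mean EFinM -hF; congr (_ * _)%E.
  by apply: eq_integral => t _; rewrite -ug.
move=> e e0.
have pe : 0 < e * (2 * pi) by rewrite mulr_gt0.
have := riemann_sum_cvg p2 cg hF pe; apply: filterS => N hN.
have -> : dmean N g = (2 * pi)^-1 * (2 * pi / N%:R *
    \sum_(m < N) (g \o cis) (m%:R * (2 * pi / N%:R))).
  rewrite /dmean [RHS]mulrA [X in _ = X * _]mulrA mulVf ?gt_eqF // mul1r.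
  congr (_ * _).
  by apply: eq_bigr => m _; rewrite /omega cisX.
by rewrite -mulrBr normrM gtr0_norm ?invr_gt0 // mulrC ler_pdivrMr.
Qed.

End CircleMeans.

(** * Second-order jets *)

Section Jets.
Variable R : realType.
Implicit Types (f g phi psi : R[i] -> R[i]) (t s : R[i]).

Lemma ler_dmean N (g h : R[i] -> R) :
  (forall t, nrm t = 1 -> g t <= h t) -> dmean N g <= dmean N h.
Proof.
move=> gh; rewrite ler_wpM2l ?invr_ge0 ?ler0n //; apply: ler_sum => m _.
by apply: gh; rewrite nrmX nrm_omega expr1n.
Qed.

Lemma dmeanD N (g h : R[i] -> R) :
  dmean N (fun t => g t + h t) = dmean N g + dmean N h.
Proof. by rewrite /dmean big_split mulrDr. Qed.

Lemma dmean_cst N (M : R) : (0 < N)%N -> dmean N (fun=> M) = M.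
Proof.
move=> N0; rewrite /dmean sumr_const card_ord -[M *+ N]mulr_natl mulKf //.
by rewrite pnatr_eq0 -lt0n.
Qed.

Lemma dmean_Re_monomial N (a : R[i]) j : (0 < j < N)%N ->
  dmean N (fun t => Re (a * t ^+ j)) = 0.
Proof.
move=> jN; rewrite /dmean -[X in _ * X](raddf_sum (Re : Rcomplex R -> R)) /=.
under eq_bigr do rewrite -exprM.
by rewrite -mulr_sumr sum_omegaX // mulr0 /= mulr0.
Qed.

(** For N > 2 the monomials t and t^2 have mean zero over the N-th roots of unity, so only the
    constants survive averaging. *)
Lemma dsub_quadratic_bound (g : R[i] -> R) (a b : R[i]) (M : R) : dsub g ->
  (forall t, nrm t = 1 -> g t <= g 0 + Re (a * t ^+ 1) + Re (b * t ^+ 2) + M) ->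
  0 <= M.
Proof.
move=> sg h; rewrite -(lerD2l (g 0)) addr0; apply/ler_addgt0Pr => e e0.
have : \forall N \near \oo, g 0 <= g 0 + M + e.
  near=> N; have N2 : (2 < N)%N by near: N; exact: nbhs_infty_gt.
  have gN : g 0 <= dmean N g + e by near: N; exact: sg.
  rewrite (le_trans gN) // lerD2r (le_trans (ler_dmean N h)) // !dmeanD.
  by rewrite !dmean_Re_monomial ?(ltnW N2) // !dmean_cst ?(ltn_trans _ N2) // !addr0.
by case=> N _ /(_ N (leqnn N)).
Unshelve. all: by end_near. Qed.

Lemma nrm_sqrD (x y : R[i]) :
  nrm (x + y) ^+ 2 = nrm x ^+ 2 + 2 * Re (x^*%C * y) + nrm y ^+ 2.
Proof. by rewrite !nrm_sqr; case: x y => [a b] [c d] /=; ring. Qed.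

Lemma near0W (P : R[i] -> Prop) : (forall s, P s) -> \forall s \near (0 : R[i]), P s.
Proof. by move=> h; apply/(@nbhs_nrmP _ R[i]); exists 1. Qed.

Lemma near0S (P Q : R[i] -> Prop) : (forall s, P s -> Q s) ->
  (\forall s \near (0 : R[i]), P s) -> \forall s \near (0 : R[i]), Q s.
Proof. exact: (@filterS _ _ (nbhs_filter (0 : R[i]))). Qed.

Lemma near0S2 (P P' Q : R[i] -> Prop) : (forall s, P s -> P' s -> Q s) ->
  (\forall s \near (0 : R[i]), P s) -> (\forall s \near (0 : R[i]), P' s) ->
  \forall s \near (0 : R[i]), Q s.
Proof. exact: (@filterS2 _ _ (nbhs_filter (0 : R[i]))). Qed.

Definition bounded_at0 (k : R[i] -> R[i]) :=
  exists M : R, \forall s \near (0 : R[i]), nrm (k s) <= M.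

Lemma bounded_at0_cst (a : R[i]) : bounded_at0 (fun=> a).
Proof. by exists (nrm a); apply: near0W => s; exact: lexx. Qed.

Lemma bounded_at0_id : bounded_at0 id.
Proof. by exists 1; apply/(@nbhs_nrmP _ R[i]); exists 1 => // y; rewrite subr0 => /ltW. Qed.

Lemma bounded_at0D k l : bounded_at0 k -> bounded_at0 l ->
  bounded_at0 (fun s => k s + l s).
Proof.
move=> [M hM] [N hN]; exists (M + N); apply: near0S2 hM hN => s hs hs'.
by rewrite (le_trans (nrmD _ _)) // lerD.
Qed.

Lemma bounded_at0M k l : bounded_at0 k -> bounded_at0 l ->
  bounded_at0 (fun s => k s * l s).
Proof.
move=> [M hM] [N hN]; exists (M * N); apply: near0S2 hM hN => s hs hs'.
by rewrite nrmM ler_pM // nrm_ge0.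
Qed.

Lemma bounded_at0N k : bounded_at0 k -> bounded_at0 (fun s => - k s).
Proof. by move=> [M hM]; exists M; apply: near0S hM => s; rewrite nrmN. Qed.

(* A complex second-order expansion is all that is used of holomorphy. *)
Definition jet phi t := exists c d k, bounded_at0 k /\
  \forall s \near (0 : R[i]), phi (t + s) = phi t + c * s + d * s ^+ 2 + s ^+ 3 * k s.

Lemma jet_continuous phi t : jet phi t -> {for t, continuous phi}.
Proof.
move=> [c [d [k [[M hM] h]]]]; apply/(@cvg_nrmP _ R[i] _ _ (nbhs_filter t)) => e e0.
have [r r0 hr] := (nbhs_nrmP (0 : R[i]) _).1 (filterI hM h).
pose C := nrm c + nrm d + `|M| + 1.
have C0 : 0 < C by rewrite ltr_wpDl // !addr_ge0 ?nrm_ge0.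
apply/(@nbhs_nrmP _ R[i]); exists (Num.min r (Num.min 1 (e / C))).
  by rewrite !lt_min r0 ltr01 divr_gt0.
move=> y; rewrite !lt_min => /and3P[yr y1 ye].
pose s := y - t; have ys : y = t + s by rewrite /s addrC subrK.
have [|kM yE] := hr s; first by rewrite subr0.
rewrite ys yE -!addrA addrC -!addrA addNr addr0 !addrA.
have s0 := nrm_ge0 s; have s1 : nrm s <= 1 by exact: ltW.
have M0 : nrm (k s) <= `|M| by rewrite (le_trans kM) ?ler_norm.
have s2 : nrm s ^+ 2 <= nrm s by rewrite expr2 ler_piMr.
have s3 : nrm s ^+ 3 <= nrm s by rewrite exprS (le_trans _ s2) // expr2 ler_wpM2l // (le_trans s2).
apply: (@le_lt_trans _ _ (C * nrm s)); last by rewrite mulrC -ltr_pdivlMr.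
have b1 : nrm (c * s) <= nrm c * nrm s by rewrite nrmM.
have b2 : nrm (d * s ^+ 2) <= nrm d * nrm s by rewrite nrmM nrmX ler_wpM2l ?nrm_ge0.
have b3 : nrm (s ^+ 3 * k s) <= `|M| * nrm s.
  by rewrite nrmM nrmX mulrC ler_pM ?exprn_ge0 ?nrm_ge0.
have := nrmD (c * s + d * s ^+ 2) (s ^+ 3 * k s); have := nrmD (c * s) (d * s ^+ 2).
rewrite /C !mulrDl; lra.
Qed.

Lemma jet_cst (a : R[i]) t : jet (fun=> a) t.
Proof.
exists 0, 0, (fun=> 0); split; first exact: bounded_at0_cst.
by apply: near0W => s; ring.
Qed.

Lemma jet_id t : jet id t.
Proof.
exists 1, 0, (fun=> 0); split; first exact: bounded_at0_cst.
by apply: near0W => s /=; ring.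
Qed.

Lemma jetD phi psi t : jet phi t -> jet psi t -> jet (fun u => phi u + psi u) t.
Proof.
move=> [c [d [k [bk h]]]] [c' [d' [k' [bk' h']]]].
exists (c + c'), (d + d'), (fun s => k s + k' s); split; first exact: bounded_at0D.
by apply: near0S2 h h' => s -> ->; ring.
Qed.

Lemma jetM phi psi t : jet phi t -> jet psi t -> jet (fun u => phi u * psi u) t.
Proof.
move=> [c [d [k [bk h]]]] [c' [d' [k' [bk' h']]]].
pose a := phi t; pose b := psi t.
(* Coefficients of the product of the two expansions; all terms of order at least 3 are collected in
   the last function. *)
exists (a * c' + c * b), (a * d' + c * c' + d * b), (fun s =>
  (a + (c * s + d * s * s) + s * s * s * k s) * k' s + (b + (c' * s + d' * s * s)) * k s +
  (c * d' + d * c' + d * d' * s)); split.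
  by do ?[apply: bounded_at0D|apply: bounded_at0M|apply: bounded_at0_cst|
     apply: bounded_at0_id|assumption].
by apply: near0S2 h h' => s -> ->; rewrite -/a -/b; ring.
Qed.

Lemma jet_sum (I : Type) (r : seq I) (F : I -> R[i] -> R[i]) t :
  (forall i, jet (F i) t) -> jet (fun u => \sum_(i <- r) F i u) t.
Proof.
move=> h; elim: r => [|i r IH].
  by under [X in jet X _]funext do rewrite big_nil; exact: jet_cst.
by under [X in jet X _]funext do rewrite big_cons; exact: jetD.
Qed.

Lemma jetX phi m t : jet phi t -> jet (fun u => phi u ^+ m) t.
Proof.
move=> h; elim: m => [|m IH].
  by under [X in jet X _]funext do rewrite expr0; exact: jet_cst.
by under [X in jet X _]funext do rewrite exprS; exact: jetM.
Qed.

Lemma jetV phi t : phi t != 0 -> jet phi t -> jet (fun u => (phi u)^-1) t.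
Proof.
move=> p0 jp; have cp := jet_continuous jp.
have a0 : 0 < nrm (phi t) by rewrite lt0r nrm_eq0 p0 nrm_ge0.
have big : \forall s \near (0 : R[i]), nrm (phi t) / 2 <= nrm (phi (t + s)).
  have /(@cvg_nrmP _ R[i] _ _ (nbhs_filter t)) /(_ (nrm (phi t) / 2)) := cp.
  rewrite divr_gt0 // => /(_ isT) /(@nbhs_nrmP _ R[i])[e e0 he].
  apply/(@nbhs_nrmP _ R[i]); exists e => // s; rewrite subr0 => se.
  have /he : nrm ((t + s) - t) < e by rewrite addrC addKr.
  have := nrmD (phi t - phi (t + s)) (phi (t + s)).
  by rewrite subrK nrmBC; lra.
case: jp => c [d [k [bk h]]]; pose a := phi t.
have bV : bounded_at0 (fun s => (phi (t + s))^-1).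
  exists (nrm (phi t) / 2)^-1; apply: near0S big => s hs.
  by rewrite nrmV lef_pV2 // posrE ?(lt_le_trans _ hs) ?divr_gt0.
(* Taylor coefficients of the reciprocal. The remainder is found by multiplying the truncated
   reciprocal by [phi (t + s)], which gives 1 + O(s^3), and dividing back. *)
exists (- c / a ^+ 2), (c ^+ 2 / a ^+ 3 - d / a ^+ 2), (fun s =>
  - (c * (c ^+ 2 - a * d) - a * c * d + d * (c ^+ 2 - a * d) * s +
     k s * (a ^+ 2 + - (a * c) * s + (c ^+ 2 - a * d) * s * s)) *
   (phi (t + s))^-1 * (a ^+ 3)^-1); split.
  by do ?[apply: bounded_at0D|apply: bounded_at0M|apply: bounded_at0N|
     apply: bounded_at0_cst|apply: bounded_at0_id|assumption].
apply: near0S2 h big => s hs bs.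
have : phi (t + s) != 0.
  by rewrite -nrm_eq0 gt_eqF // (lt_le_trans _ bs) // divr_gt0.
rewrite hs -/a => n0; field; rewrite n0 andbT.
exact: p0.
Qed.

End Jets.

(** * Maximum principle on holomorphic discs *)

Section MaximumPrinciple.
Variable R : realType.
Implicit Types (s t x c : R[i]).


Lemma Re_realM (a : R) (z : R[i]) : Re (a%:C%C * z) = a * Re z.
Proof. by case: z => x y /=; rewrite mul0r subr0. Qed.

(* Maximize [U (t, phi t + k) + tau |t|^2 - L |k|^2] over [(t, k)].  If the maximum
   [(t2, k2)] is interior, moving along the tangent line to
   [(t2 + s, x2 + c s)] amounts to replacing [k2] by [k2 - d s^2 - O(s^3)], which
   costs only [O(|s|^3)] in the mean, whereas [tau |t|^2] gains [tau |s|^2]. *)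
Lemma jet_max_principle (U : R[i] * R[i] -> R) (E : set (R[i] * R[i]))
    (phi : R[i] -> R[i]) :
  open E -> (forall p, E p -> {for p, continuous U}) ->
  (forall t x c, E (t, x) -> exists2 d : R, 0 < d & forall r : R, 0 < r < d ->
     dsub (fun z => U (t + r%:C%C * z, x + c * (r%:C%C * z)))) ->
  (forall t, nrm t <= 1 -> jet phi t) ->
  (forall t, nrm t <= 1 -> E (t, phi t)) ->
  exists2 t0, nrm t0 = 1 & forall t, nrm t <= 1 -> U (t, phi t) <= U (t0, phi t0).
Proof.
move=> oE cU sU jphi Ephi.
have cphi t : nrm t <= 1 -> {for t, continuous phi} by move=> /jphi/jet_continuous.
pose D1 : set R[i] := [set t | nrm t <= 1].
pose S1 : set R[i] := [set t | nrm t = 1].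
have cgraph (p : R[i] * R[i]) : nrm p.1 <= 1 ->
    {for p, continuous (fun q : R[i] * R[i] => (q.1, phi q.1 + q.2))}.
  move=> p1.
  have c1 : (q.1 : R[i]) @[q --> p] --> p.1 by exact: cvg_fst.
  have c2 : (phi q.1 + q.2 : R[i]) @[q --> p] --> phi p.1 + p.2.
    apply: cvgD; last exact: cvg_snd.
    exact: (cvg_comp _ _ c1 (cphi _ p1)).
  exact: (cvg_pair c1 c2).
have cUgraph (p : R[i] * R[i]) : nrm p.1 <= 1 -> E (p.1, phi p.1 + p.2) ->
    {for p, continuous (fun q : R[i] * R[i] => U (q.1, phi q.1 + q.2))}.
  move=> p1 Ep; apply: (@continuous_comp _ _ _
    (fun q : R[i] * R[i] => (q.1, phi q.1 + q.2)) U); first exact: cgraph.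
  exact: cU.
have cg t : nrm t <= 1 -> {for t, continuous (fun t => U (t, phi t))}.
  move=> t1; apply: (@continuous_comp _ _ _ (fun t => (t, phi t)) U).
    exact: (cvg_pair (@cvg_id _ (nbhs t)) (cphi _ t1)).
  by apply: cU; exact: Ephi.
have [||t0 t0S maxS] := @compact_EVT_max _ _ (fun t => U (t, phi t)) S1 _ (@compact_circle R).
- by exists 1; exact: nrm1.
- by apply: continuous_in_subspaceT => t /set_mem t1; apply: cg; rewrite t1.
exists t0; first exact: set_mem t0S.
move=> t1 t1D; rewrite leNgt; apply/negP => lt01.
(* A third of the supposed excess: one share pays for the variation of [U] in the tube below, one
   for the term [tau |t|^2], and one keeps the contradiction strict. *)
pose tau := (U (t1, phi t1) - U (t0, phi t0)) / 3.
have tau0 : 0 < tau by rewrite divr_gt0 // subr_gt0.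
have tauE : U (t1, phi t1) = U (t0, phi t0) + 3 * tau by rewrite /tau; field.
have tube : \forall k \near (0 : R[i]), forall t, D1 t ->
    E (t, phi t + k) /\ `|U (t, phi t + k) - U (t, phi t)| <= tau.
  apply: (compact_near_forall (nbhs_filter (0 : R[i]))); first exact: compact_disc.
  move=> t t1'.
  have Et : E (t, phi t + 0) by rewrite addr0; exact: Ephi.
  have hE : \forall q \near nbhs ((t, 0) : R[i] * R[i]), E (q.1, phi q.1 + q.2).
    exact: (cgraph (t, 0) t1' E (open_nbhs_nbhs (conj oE Et))).
  have t2 : 0 < tau / 2 by rewrite divr_gt0.
  have /cvgrPdist_lt /(_ _ t2) hU := cUgraph (t, 0) t1' Et.
  have [[A B] [/= nA nB] hAB] := filterI hE hU.
  exists A => //; exists B => // y k Ay Bk.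
  have [E1 U1] := hAB (y, k) (conj Ay Bk).
  have [_ U2] := hAB (y, 0) (conj Ay (nbhs_singleton nB)).
  split=> //; move: U1 U2; rewrite /= !addr0.
  have := ler_distD (U (t, phi t)) (U (y, phi y + k)) (U (y, phi y)).
  by rewrite (distrC (U (y, phi y + k)) (U (t, _))); lra.
have [k00 k00p htube] := (nbhs_nrmP (0 : R[i]) _).1 tube.
pose k0 := k00 / 2; have k0p : 0 < k0 by rewrite divr_gt0.
have {}htube t k : nrm t <= 1 -> nrm k <= k0 ->
    E (t, phi t + k) /\ `|U (t, phi t + k) - U (t, phi t)| <= tau.
  by move=> ht hk; apply: htube => //; rewrite subr0 (le_lt_trans hk) // /k0; lra.
(* On [|k| = k0] the penalty is then [2 * tau], more than the [tau] by which [U] can vary in the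
   tube, so the maximum of [J] is not attained there. *)
pose L := 2 * tau / k0 ^+ 2.
have L0 : 0 < L by apply: divr_gt0; [exact: mulr_gt0|exact: exprn_gt0].
have Lk : L * k0 ^+ 2 = 2 * tau by rewrite /L; field; rewrite gt_eqF.
pose J (p : R[i] * R[i]) := U (p.1, phi p.1 + p.2) + tau * nrm p.1 ^+ 2 - L * nrm p.2 ^+ 2.
have [||[t2 k2] /set_mem[/= t2D k2D] maxJ] := @compact_EVT_max _ _ J
    (D1 `*` [set k | nrm k <= k0]) _ (compact_setX (@compact_disc R 1) (@compact_disc R k0)).
- by exists (0, 0); split; rewrite /= /D1 /= nrm0 ?ler01 // ltW.
- apply: continuous_in_subspaceT => -[t k] /set_mem[/= tD kD].
  have cfst : nrm (q.1 : R[i]) @[q --> (t, k)] --> nrm t.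
    exact: (cvg_comp _ _ (@cvg_fst _ _ (nbhs t) (nbhs k) _) (@nrm_continuous _ _ t)).
  have csnd : nrm (q.2 : R[i]) @[q --> (t, k)] --> nrm k.
    exact: (cvg_comp _ _ (@cvg_snd _ _ (nbhs t) (nbhs k) _) (@nrm_continuous _ _ k)).
  apply: cvgB; last by apply: cvgM; [exact: cvg_cst|exact: (cvgM csnd csnd)].
  apply: cvgD; first by apply: cUgraph => //; case: (htube t k tD kD).
  by apply: cvgM; [exact: cvg_cst|exact: (cvgM cfst cfst)].
have {}maxJ t k : nrm t <= 1 -> nrm k <= k0 -> J (t, k) <= J (t2, k2).
  by move=> ht hk; apply: maxJ; apply/mem_set.
(* On the circle [J] is at most [U (t0, phi t0) + 2 * tau], which is less than its value at
   [(t1, 0)]. *)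
have t2lt : nrm t2 < 1.
  rewrite lt_neqAle t2D andbT; apply/eqP => t21.
  have := maxJ t1 0 t1D; rewrite nrm0 => /(_ (ltW k0p)); rewrite /J /= nrm0 addr0 t21.
  have [_] := htube t2 k2 t2D k2D; have := maxS t2 (mem_set t21).
  have : 0 <= L * nrm k2 ^+ 2 by rewrite mulr_ge0 ?sqr_ge0 // ltW.
  have : 0 <= tau * nrm t1 ^+ 2 by rewrite mulr_ge0 ?sqr_ge0 // ltW.
  by rewrite tauE ler_norml expr0n /= mulr0 subr0 expr1n; lra.
have k2lt : nrm k2 < k0.
  rewrite lt_neqAle k2D andbT; apply/eqP => k20.
  have := maxJ t2 0 t2D; rewrite nrm0 => /(_ (ltW k0p)); rewrite /J /= nrm0 addr0 k20 Lk.
  have [_] := htube t2 k2 t2D k2D.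
  by rewrite ler_norml expr0n /= mulr0 subr0; lra.
have [c [d [k [[K0 hK0] hk]]]] := jphi t2 t2D.
have [rj rj0 hrj] := (nbhs_nrmP (0 : R[i]) _).1 (filterI hK0 hk).
pose K := `|K0|; have K_ge0 : 0 <= K by exact: normr_ge0.
have [rs rs0 hrs] := sU t2 (phi t2 + k2) c (htube t2 k2 t2D k2D).1.
(* Bounds the [rho^3] coefficient of [|k2 - h|^2] below: the first summand comes from the cubic part
   of the cross term, the second from [|h|^2]. *)
pose C := 2 * nrm k2 * K + (nrm d + K) ^+ 2.
have C0 : 0 <= C by rewrite addr_ge0 ?sqr_ge0 // mulr_ge0 // mulr_ge0 ?nrm_ge0.
pose dk := nrm d + K + 1.
have dk0 : 0 < dk by rewrite ltr_wpDl // addr_ge0 ?nrm_ge0.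
(* Radii below [m] lie in the range of the jet and of the submean property, keep [t2 + s] and
   [k2 - h] admissible, and satisfy [L * C * rho < tau]. *)
pose m := Num.min 1 (Num.min rj (Num.min rs (Num.min (1 - nrm t2)
  (Num.min ((k0 - nrm k2) / dk) (tau / (L * C + 1)))))).
have LC0 : 0 < L * C + 1 by rewrite ltr_wpDl // mulr_ge0 // ltW.
have m0 : 0 < m.
  by rewrite !lt_min ltr01 rj0 rs0 subr_gt0 t2lt !divr_gt0 // subr_gt0.
pose rho := m / 2; have rho0 : 0 < rho by rewrite divr_gt0.
have : rho < m by rewrite /rho; lra.
rewrite !lt_min => /and5P[rho1 rhoj rhos rhot /andP[rhok rhoC]].
have ds := hrs rho; rewrite rho0 rhos in ds; have {}ds := ds isT.
have rhoe : nrm (rho%:C%C : R[i]) = rho by rewrite nrm_real gtr0_norm.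
(* The linear coefficient comes from [|t2 + s|^2], the quadratic one from [|k2 - d s^2|^2]; the
   constant left over is negative, contrary to the lemma. *)
have := @dsub_quadratic_bound _ _ (- 2 * tau%:C * (t2^* * rho%:C))%C
  (- 2 * L%:C * (k2^* * d * rho%:C ^+ 2))%C (- tau * rho ^+ 2 + L * (C * rho ^+ 3)) ds.
suff main : forall t, nrm t = 1 ->
    U (t2 + rho%:C%C * t, phi t2 + k2 + c * (rho%:C%C * t)) <=
    U (t2 + rho%:C%C * 0, phi t2 + k2 + c * (rho%:C%C * 0)) +
    Re (- 2 * tau%:C * (t2^* * rho%:C) * t ^+ 1)%C +
    Re (- 2 * L%:C * (k2^* * d * rho%:C ^+ 2) * t ^+ 2)%C +
    (- tau * rho ^+ 2 + L * (C * rho ^+ 3)).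
  move=> /(_ main); apply/negP; rewrite -ltNge.
  have -> : - tau * rho ^+ 2 + L * (C * rho ^+ 3) = - rho ^+ 2 * (tau - L * C * rho) by ring.
  rewrite mulNr oppr_lt0 mulr_gt0 ?exprn_gt0 // subr_gt0.
  move: rhoC; rewrite ltr_pdivlMr // => h; rewrite (le_lt_trans _ h) //; nra.
move=> w w1; pose s := rho%:C%C * w.
have sE : nrm s = rho by rewrite nrmM w1 mulr1.
have [|/= ks phis] := hrj s; first by rewrite subr0 sE.
have {}ks : nrm (k s) <= K by rewrite (le_trans ks) ?ler_norm.
(* The deviation of [phi] from its tangent at [t2]; shifting [k2] by [- h] puts the competitor on
   the tangent line. *)
pose h := d * s ^+ 2 + s ^+ 3 * k s.
have hle : nrm h <= (nrm d + K) * rho ^+ 2.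
  have := nrmD (d * s ^+ 2) (s ^+ 3 * k s).
  have -> : nrm (d * s ^+ 2) = nrm d * rho ^+ 2 by rewrite nrmM nrmX sE.
  have -> : nrm (s ^+ 3 * k s) = nrm (k s) * rho ^+ 3 by rewrite nrmM nrmX sE mulrC.
  have : nrm (k s) * rho ^+ 3 <= K * rho ^+ 2.
    rewrite ler_pM ?nrm_ge0 ?exprn_ge0 ?(ltW rho0) //.
    by rewrite exprS ler_piMl ?sqr_ge0 // ltW.
  rewrite /h mulrDl; lra.
have rho2 : rho ^+ 2 <= rho by rewrite expr2 ler_piMl // ltW.
have := maxJ (t2 + s) (k2 - h).
have h1 : nrm (t2 + s) <= 1 by have := nrmD t2 s; rewrite sE; lra.
have h2 : nrm (k2 - h) <= k0.
  have := nrmD k2 (- h); rewrite nrmN.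
  move: rhok; rewrite ltr_pdivlMr // /dk => rhok.
  have : (nrm d + K) * rho ^+ 2 <= (nrm d + K) * rho.
    by rewrite ler_wpM2l // addr_ge0 ?nrm_ge0.
  lra.
move=> /(_ h1 h2); rewrite /J /=.
have -> : phi (t2 + s) + (k2 - h) = phi t2 + k2 + c * s by rewrite phis /h; ring.
rewrite -/s !mulr0 !addr0 !nrm_sqrD nrmN sE.
have hsq : nrm h ^+ 2 <= (nrm d + K) ^+ 2 * rho ^+ 3.
  rewrite (@le_trans _ _ (((nrm d + K) * rho ^+ 2) ^+ 2)) //.
    by rewrite ler_sqr ?nnegrE ?nrm_ge0 // mulr_ge0 ?sqr_ge0 // addr_ge0 ?nrm_ge0.
  rewrite exprMn ler_wpM2l ?sqr_ge0 // -exprM (exprS rho 3).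
  by rewrite ler_piMl ?exprn_ge0 // ltW.
have hre : - Re (k2^* * (s ^+ 3 * k s))%C <= nrm k2 * K * rho ^+ 3.
  rewrite (le_trans (ler_norm _)) // normrN (le_trans (ler_Re_nrm _)) //.
  rewrite nrmM (nrmM (s ^+ 3)) nrmX sE {1}/nrm normcJ -/(nrm k2) -mulrA ler_wpM2l ?nrm_ge0 //.
  by rewrite mulrC ler_wpM2r // exprn_ge0 // ltW.
have N2E (a : R) : ((- 2 * a)%:C = - 2 * a%:C)%C.
  by rewrite rmorphM rmorphN rmorph_nat.
have e1 : Re (- 2 * tau%:C * (t2^* * rho%:C) * w ^+ 1)%C = - 2 * tau * Re (t2^*%C * s).
  rewrite -Re_realM; congr Re.
  by rewrite /s N2E; ring.
have e2 : Re (- 2 * L%:C * (k2^* * d * rho%:C ^+ 2) * w ^+ 2)%C =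
    - 2 * L * Re (k2^*%C * (d * s ^+ 2)).
  rewrite -Re_realM; congr Re.
  by rewrite /s N2E; ring.
have e3 : Re (k2^*%C * - h) = - Re (k2^*%C * (d * s ^+ 2)) - Re (k2^* * (s ^+ 3 * k s))%C.
  by rewrite /h mulrN mulrDr raddfN /= raddfD /= opprD.
rewrite e1 e2 e3 => hJ.
have : L * (nrm h ^+ 2 - 2 * Re (k2^* * (s ^+ 3 * k s))%C) <= L * (C * rho ^+ 3).
  by rewrite ler_pM2l // /C mulrDl; lra.
by move: hJ; lra.
Qed.

End MaximumPrinciple.

(** * Fejer majorants and local submean property *)

Section Fejer.
Variable R : realType.
Implicit Types (t z w : R[i]) (g : R[i] -> R).

(** Near the diagonal continuity gives the bound [e]; away from it a large [C] makes the quadratic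
    term dominate; compactness makes [C] uniform. The square matches the decay of the Fejer
    kernel. *)
Lemma circle_modulus g : (forall t, nrm t = 1 -> {for t, continuous g}) ->
  forall e : R, 0 < e -> exists2 C : R, 0 <= C &
    forall z w, nrm z = 1 -> nrm w = 1 -> g z - g w <= e + C * nrm (z - w) ^+ 2.
Proof.
move=> cg e e0.
have e2 : 0 < e / 2 by rewrite divr_gt0.
have unif : \forall C \near +oo%R, forall p : R[i] * R[i],
    ([set t | nrm t = 1] `*` [set t | nrm t = 1]) p ->
    g p.1 - g p.2 <= e + C * nrm (p.1 - p.2) ^+ 2.
  apply: compact_near_forall; first by apply: compact_setX; exact: compact_circle.
  move=> [z w] [/= z1 w1].
  have /cvgrPdist_lt /(_ _ e2) nz := cg z z1.
  have /cvgrPdist_lt /(_ _ e2) nw := cg w w1.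
  pose mu := nrm (z - w).
  have nmu : \forall p \near nbhs ((z, w) : R[i] * R[i]), mu / 2 <= nrm (p.1 - p.2).
    have [->|zw] := eqVneq mu 0; first by apply: nearW => p; rewrite mul0r nrm_ge0.
    have mu2 : 0 < mu / 2 by rewrite divr_gt0 // lt0r zw nrm_ge0.
    have c1 : nrm (p.1 - p.2 : R[i]) @[p --> (z, w)] --> mu.
      have c2 : (p.1 - p.2 : R[i]) @[p --> (z, w)] --> z - w.
        by apply: cvgB; [exact: cvg_fst|exact: cvg_snd].
      exact: (cvg_comp _ _ c2 (@nrm_continuous _ _ (z - w))).
    move/cvgrPdist_lt : c1 => /(_ _ mu2); apply: filterS => p /=.
    by rewrite ltr_norml; lra.
  have [[A B] [/= nA nB] AB] := nmu.
  exists ([set p | `|g z - g p.1| < e / 2 /\ `|g w - g p.2| < e / 2 /\ mu / 2 <= nrm (p.1 - p.2)]).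
    exists ([set y | `|g z - g y| < e / 2] `&` A, [set y | `|g w - g y| < e / 2] `&` B).
      by split; exact: filterI.
    by move=> [y y'] [/= [? ?] [? ?]]; do !split => //; exact: (AB (y, y')).
  exists [set C | 0 <= C /\ (g z - g w) <= C * (mu / 2) ^+ 2].
    have [mu0|mu0] := eqVneq mu 0.
      have -> : z = w by apply/eqP; rewrite -subr_eq0 -nrm_eq0; apply/eqP.
      near=> C => /=; rewrite subrr; have C0 : 0 <= C by near: C; exact: nbhs_pinfty_ge.
      by rewrite mulr_ge0 ?sqr_ge0.
    have mu2 : 0 < (mu / 2) ^+ 2 by rewrite exprn_gt0 // divr_gt0 // lt0r mu0 nrm_ge0.
    near=> C => /=; split; first by near: C; exact: nbhs_pinfty_ge.
    rewrite -ler_pdivrMr //; near: C; apply: nbhs_pinfty_ge; exact: num_real.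
  move=> [y y'] C [/= + [+ mule]] [C0 hC]; rewrite !ltr_norml => h1 h2.
  have : C * (mu / 2) ^+ 2 <= C * nrm (y - y') ^+ 2.
    by rewrite ler_wpM2l // ler_sqr ?nnegrE ?nrm_ge0 // divr_ge0 // nrm_ge0.
  lra.
have [C [C0 hC]] : exists C : R, 0 <= C /\ forall p : R[i] * R[i],
    ([set t | nrm t = 1] `*` [set t | nrm t = 1]) p ->
    g p.1 - g p.2 <= e + C * nrm (p.1 - p.2) ^+ 2.
  have pos : \forall C \near +oo%R, (0 : R) <= C by exact: nbhs_pinfty_ge.
  by have [C hC] := filter_ex (filterI pos unif); exists C.
by exists C => // z w z1 w1; exact: (hC (z, w)).
Unshelve. all: by end_near. Qed.

(* The analytic completion of the Fejer kernel: its real part on the unit circle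
   is [|1 + z + ... + z^(N-1)|^2 / N].  The exponent is [|k - l|]. *)
Definition fejer_kernel (N : nat) z : R[i] :=
  N%:R^-1 * \sum_(k < N) \sum_(l < N) z ^+ ((k - l) + (l - k)).

Lemma sum_diag_delta N : \sum_(k < N) \sum_(l < N) (((k - l) + (l - k))%N == 0%N)%:R = N%:R :> R[i].
Proof.
rewrite -[RHS]mulr1 mulr_natl -[X in _ *+ X](card_ord N) -sumr_const.
apply: eq_bigr => k _; rewrite (bigD1 k) //= subnn eqxx big1 ?addr0 // => l lk.
rewrite addn_eq0 !subn_eq0 -eqn_leq; apply/eqP; rewrite pnatr_eq0 eqb0.
by apply: contra lk => /eqP kl; apply/eqP/val_inj; rewrite /= kl.
Qed.

Lemma fejer_kernel0 N : (0 < N)%N -> fejer_kernel N 0 = 1.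
Proof.
move=> N0; rewrite /fejer_kernel.
under eq_bigr do under eq_bigr do rewrite expr0n.
by rewrite sum_diag_delta mulVf // pnatr_eq0 -lt0n.
Qed.

Lemma Re_sum (I : Type) (r : seq I) (P : pred I) (F : I -> R[i]) :
  Re (\sum_(i <- r | P i) F i) = \sum_(i <- r | P i) Re (F i).
Proof. by apply: (big_morph (Re : R[i] -> R)) => // -[a b] [c d]. Qed.

Lemma conj_circle z : nrm z = 1 -> z * z^*%C = 1.
Proof. by move=> z1; rewrite -sqr_normc nrmE z1 expr1n. Qed.

Lemma nrm_conj z : nrm z^*%C = nrm z.
Proof. by rewrite /nrm normcJ. Qed.

(** Expand the square of the modulus: on the circle the product of z^k and the conjugate of z^l is
    z^(k-l) or the conjugate of z^(l-k), and conjugation preserves real parts. *)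
Lemma Re_fejer_kernel N z : nrm z = 1 ->
  Re (fejer_kernel N z) = N%:R^-1 * nrm (\sum_(k < N) z ^+ k) ^+ 2.
Proof.
move=> z1; have ReJ (x : R[i]) : Re x^*%C = Re x by case: x.
have -> : fejer_kernel N z = (N%:R^-1)%:C%C *
    \sum_(k < N) \sum_(l < N) z ^+ ((k - l) + (l - k)).
  by rewrite fmorphV rmorph_nat.
rewrite Re_realM; congr (_ * _).
have -> : nrm (\sum_(k < N) z ^+ k) ^+ 2 =
    Re ((\sum_(k < N) z ^+ k) * (\sum_(k < N) z ^+ k)^*%C).
  by rewrite -sqr_normc nrmE -rmorphXn.
rewrite rmorph_sum big_distrlr /= !Re_sum; apply: eq_bigr => k _.
rewrite !Re_sum; apply: eq_bigr => l _; rewrite rmorphXn /=.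
have zX m : z ^+ m * z^*%C ^+ m = 1 by rewrite -exprMn conj_circle // expr1n.
have [kl|/ltnW lk] := leqP k l.
  move: kl; rewrite -subn_eq0 => /eqP kl0; rewrite kl0 add0n.
  rewrite -{2}(subnKC (_ : (k <= l)%N)) ?exprD ?mulrA ?zX ?mul1r; last by rewrite -subn_eq0 kl0.
  by rewrite -[LHS]ReJ rmorphXn.
move: (lk); rewrite -subn_eq0 => /eqP ->; rewrite addn0.
by rewrite -{2}(subnK lk) exprD -mulrA zX mulr1.
Qed.

Lemma Re_fejer_kernel_ge0 N z : nrm z = 1 -> 0 <= Re (fejer_kernel N z).
Proof. by move=> z1; rewrite Re_fejer_kernel // mulr_ge0 ?invr_ge0 ?sqr_ge0. Qed.

(** Summing the geometric series turns the left side into [|z^N - 1|^2 / N]. *)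
Lemma Re_fejer_kernel_decay N z : (0 < N)%N -> nrm z = 1 ->
  nrm (z - 1) ^+ 2 * Re (fejer_kernel N z) <= 4 / N%:R.
Proof.
move=> N0 z1; rewrite Re_fejer_kernel // mulrCA [4 / _]mulrC.
rewrite ler_wpM2l ?invr_ge0 // -exprMn -nrmM -subrX1.
have : nrm (z ^+ N - 1) <= 2.
  by rewrite (le_trans (nrmD _ _)) // nrmN nrm1 nrmX z1 expr1n.
by have := nrm_ge0 (z ^+ N - 1); nra.
Qed.

(** Off the diagonal the exponent lies strictly between 0 and N, and the corresponding sum over
    roots of unity vanishes. *)
Lemma sum_fejer_kernel N z : (0 < N)%N ->
  \sum_(m < N) fejer_kernel N (z * (omega R N ^+ m)^*%C) = N%:R.
Proof.
move=> N0; rewrite -mulr_sumr exchange_big /=.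
under eq_bigr => k _ do rewrite exchange_big /=.
have E (k l : 'I_N) : \sum_(m < N) (z * (omega R N ^+ m)^*%C) ^+ ((k - l) + (l - k)) =
    N%:R * (((k - l) + (l - k))%N == 0%N)%:R.
  set d := ((k - l) + (l - k))%N.
  have [->|d0] := eqVneq d 0%N.
    under eq_bigr do rewrite expr0.
    by rewrite sumr_const card_ord mulr1.
  have dN : (0 < d < N)%N.
    by rewrite lt0n d0 /=; move: (ltn_ord k) (ltn_ord l); rewrite /d; lia.
  under eq_bigr do rewrite exprMn -rmorphXn -exprM.
  by rewrite -mulr_sumr -rmorph_sum sum_omegaX // rmorph0 !mulr0.
under eq_bigr => k _ do under eq_bigr => l _ do rewrite E.
under eq_bigr => k _ do rewrite -mulr_sumr.
by rewrite -mulr_sumr sum_diag_delta mulKf // pnatr_eq0 -lt0n.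
Qed.

(** The discrete Fejer sum of [g] over the N-th roots of unity, raised by [e]. Its weights are
    nonnegative with total N, so by [circle_modulus] and the kernel decay it falls short of [g] by
    at most [e / 2 + 4 C / N] before being raised. It is a polynomial, hence has jets everywhere. *)
Lemma fejer_majorant g : (forall t, nrm t = 1 -> {for t, continuous g}) ->
  forall e : R, 0 < e -> \forall N \near \oo, exists f : R[i] -> R[i],
    [/\ forall t, jet f t, f 0 = (dmean N g + e)%:C%C &
       forall t, nrm t = 1 -> g t <= Re (f t)].
Proof.
move=> cg e e0.
have e2 : 0 < e / 2 by rewrite divr_gt0.
have [C C0 hC] := circle_modulus cg e2.
near=> N.
have N0 : (0 < N)%N by near: N; exact: nbhs_infty_gt.
have N0' : (0 : R) < N%:R by rewrite ltr0n.
have NC : 4 * C / (e / 2) <= N%:R by near: N; exact: nbhs_infty_ger.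
pose om m := omega R N ^+ m.
have om1 m : nrm (om m) = 1 by rewrite nrmX nrm_omega expr1n.
pose f z : R[i] := \sum_(m < N) ((g (om m) / N%:R)%:C%C * fejer_kernel N (z * (om m)^*%C)) + e%:C%C.
exists f; split.
- move=> t; apply: jetD; last exact: jet_cst.
  apply: jet_sum => m; apply: jetM; first exact: jet_cst.
  apply: jetM; first exact: jet_cst.
  apply: jet_sum => k; apply: jet_sum => l; apply: jetX; apply: jetM; last exact: jet_cst.
  exact: jet_id.
- rewrite /f rmorphD /=; congr (_ + _).
  under eq_bigr do rewrite mul0r fejer_kernel0 // mulr1.
  by rewrite -rmorph_sum /dmean mulr_sumr; congr (_%:C%C); apply: eq_bigr => m _; rewrite mulrC.
move=> t t1; pose K m := Re (fejer_kernel N (t * (om m)^*%C)).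
have tm1 m : nrm (t * (om m)^*%C) = 1 by rewrite nrmM nrm_conj t1 om1 mulr1.
have sumK : \sum_(m < N) K m = N%:R.
  by rewrite /K -Re_sum sum_fejer_kernel // -(rmorph_nat (real_complex R)).
have -> : Re (f t) = N%:R^-1 * \sum_(m < N) g (om m) * K m + e.
  rewrite /f raddfD /= Re_sum mulr_sumr; congr (_ + _); apply: eq_bigr => m _.
  by rewrite Re_realM mulrAC mulrC.
rewrite -lerBlDr ler_pdivlMl //.
have term m : g t * K m - g (om m) * K m <= e / 2 * K m + C * (4 / N%:R).
  have h1 := hC t (om m) t1 (om1 m).
  have K0 : 0 <= K m by exact: Re_fejer_kernel_ge0.
  have tE : nrm (t - om m) = nrm (t * (om m)^*%C - 1).
    by rewrite -(conj_circle (om1 m)) -mulrBl nrmM nrm_conj om1 mulr1.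
  have h2 := Re_fejer_kernel_decay N0 (tm1 m); rewrite -/(K m) -tE in h2.
  rewrite -mulrBl (le_trans (ler_wpM2r K0 h1)) // mulrDl lerD2l -mulrA.
  by rewrite ler_wpM2l.
have : \sum_(m < N) (g t * K m - g (om m) * K m) <=
    \sum_(m < N) (e / 2 * K m + C * (4 / N%:R)) by apply: ler_sum.
rewrite sumrB big_split /=.
have -> : \sum_(m < N) g t * K m = g t * N%:R by rewrite -mulr_sumr sumK.
have -> : \sum_(m < N) e / 2 * K m = e / 2 * N%:R by rewrite -mulr_sumr sumK.
have -> : \sum_(m < N) C * (4 / N%:R) = 4 * C.
  by rewrite sumr_const card_ord -[LHS]mulr_natr; field; rewrite gt_eqF.
move: NC; rewrite ler_pdivrMr //; lra.
Unshelve. all: by end_near. Qed.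

(** The Fejer majorant has the real value [dmean N g + e] at 0, so comparison with holomorphic
    majorants yields exactly the inequality in [dsub]. *)
Lemma dsub_of_jet_majorants g : (forall t, nrm t = 1 -> {for t, continuous g}) ->
  (forall f, (forall t, jet f t) -> Im (f 0) = 0 ->
     (forall t, nrm t = 1 -> g t <= Re (f t)) -> g 0 <= Re (f 0)) ->
  dsub g.
Proof.
move=> cg h e e0; have := fejer_majorant cg e0.
by apply: filterS => N [f [jf f0 gf]]; have := h f jf; rewrite f0; exact.
Qed.

Lemma dsubD_Re_affine g (a b : R[i]) : dsub g -> dsub (fun t => g t + Re (b + a * t)).
Proof.
move=> sg e e0; near=> N.
have N1 : (1 < N)%N by near: N; exact: nbhs_infty_gt.
have gN : g 0 <= dmean N g + e by near: N; exact: sg.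
rewrite dmeanD mulr0 addr0.
have -> : dmean N (fun t => Re (b + a * t)) = Re b.
  have -> : (fun t => Re (b + a * t)) = (fun t => Re b + Re (a * t ^+ 1)).
    by apply/funext => t; rewrite raddfD.
  by rewrite dmeanD dmean_cst ?(ltnW N1) // dmean_Re_monomial ?addr0.
by rewrite addrAC lerD2r.
Unshelve. all: by end_near. Qed.

Lemma dsub_cst (c : R) : dsub (fun=> c : R).
Proof.
move=> e e0; near=> N.
have N0 : (0 < N)%N by near: N; exact: nbhs_infty_gt.
by rewrite dmean_cst // lerDl ltW.
Unshelve. all: by end_near. Qed.

(** Minimum principle for the harmonic function [Re f]: the maximum principle applies to minus the
    real part of the second coordinate, which is affine on lines. *)
Lemma Re_gt0_in_disc f : (forall t, nrm t <= 1 -> jet f t) ->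
  (forall t, nrm t = 1 -> 0 < Re (f t)) -> forall t, nrm t <= 1 -> 0 < Re (f t).
Proof.
move=> jf f0 t t1.
have [|||||t0 t01 /(_ t t1)] := @jet_max_principle R (fun p => - Re p.2) setT f.
- exact: openT.
- move=> p _; apply: cvgN.
  exact: (cvg_comp _ _ (@cvg_snd _ _ (nbhs p.1) (nbhs p.2) _) (@Re_continuous R p.2)).
- move=> s x c _; exists 1 => // r _.
  have -> : (fun z => - Re (x + c * (r%:C%C * z))) =
      (fun z => 0 + Re (- x + (- c * r%:C%C) * z)).
    by apply/funext => z; rewrite add0r -raddfN opprD mulrA mulNr mulNr.
  exact/dsubD_Re_affine/dsub_cst.
- exact: jf.
- by [].
- by rewrite lerN2; apply: lt_le_trans; exact: f0.
Qed.

End Fejer.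

(** * From small circles to all discs in a complex line *)

Section LocalToGlobal.
Variables (R : realType) (V : normedModType R[i]).
Implicit Types (A : set V) (u : V -> R) (z w : V).

Definition disc_in A z w := forall t : R[i], nrm t <= 1 -> A (z + t *: w).

Definition locally_submean A u := forall z w, A z ->
  exists2 d : R, 0 < d & forall r : R, 0 < r < d ->
    dsub (fun t : R[i] => u (z + (r%:C%C * t) *: w)).

Lemma line_continuous (z w : V) : continuous (fun t : R[i] => z + t *: w).
Proof.
move=> t; apply/(@cvg_nrmP _ _ _ _ (nbhs_filter t)) => e e0.
have w1 : 0 < nrm w + 1 by rewrite ltr_wpDl // nrm_ge0.
apply/(@nbhs_nrmP _ R[i]); exists (e / (nrm w + 1)); first by rewrite divr_gt0.
move=> s; rewrite ltr_pdivlMr // => hs.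
rewrite opprD addrACA subrr add0r -scalerBl nrmZ (le_lt_trans _ hs) //.
by rewrite ler_wpM2l ?nrm_ge0 // lerDl.
Qed.

(** For a holomorphic majorant [f] on the circle, [u (z + t w) - Re x] is locally submean in
    [(t, x)]; the maximum principle on the graph of [f] carries the bound from the circle to the
    centre. *)
Lemma locally_submean_dsub A u : open A -> (forall z, A z -> {for z, continuous u}) ->
  locally_submean A u ->
  forall z w, disc_in A z w -> dsub (fun t : R[i] => u (z + t *: w)).
Proof.
move=> oA cu lu z w zw.
have cuw (t : R[i]) : A (z + t *: w) -> {for t, continuous (fun t : R[i] => u (z + t *: w))}.
  move=> At; apply: (@continuous_comp _ _ _ (fun t : R[i] => z + t *: w) u).
    exact: line_continuous.
  exact: cu.
apply: dsub_of_jet_majorants => [t t1|f jf f0 gf].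
  by apply: cuw; apply: zw; rewrite t1.
have [|||||t0 t01 /(_ 0)] := @jet_max_principle R
  (fun p : R[i] * R[i] => u (z + p.1 *: w) - Re p.2) [set p : R[i] * R[i] | A (z + p.1 *: w)] f.
- apply: (@open_comp _ _ (fun p : R[i] * R[i] => z + p.1 *: w) A) => // p _.
  exact: (cvg_comp _ _ (@cvg_fst _ _ (nbhs p.1) (nbhs p.2) _) (@line_continuous z w p.1)).
- move=> p Ap; apply: cvgB.
    exact: (cvg_comp _ _ (@cvg_fst _ _ (nbhs p.1) (nbhs p.2) _) (cuw p.1 Ap)).
  exact: (cvg_comp _ _ (@cvg_snd _ _ (nbhs p.1) (nbhs p.2) _) (@Re_continuous R p.2)).
- move=> t x c /= At; have [d d0 hd] := lu _ w At; exists d => // r rd.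
  have -> : (fun s : R[i] => u (z + (t + r%:C%C * s) *: w) - Re (x + c * (r%:C%C * s))) =
      (fun s : R[i] => u ((z + t *: w) + (r%:C%C * s) *: w) + Re (- x + (- c * r%:C%C) * s)).
    apply/funext => s; rewrite -raddfN opprD mulrA mulNr mulNr; congr (u _ + _).
    by rewrite scalerDl addrA.
  exact/dsubD_Re_affine/hd.
- by move=> t _; exact: jf.
- by move=> t t1 /=; exact: zw.
- rewrite nrm0 => /(_ ler01); have := gf t0 t01; rewrite -subr_le0 => h1 h2.
  by rewrite -subr_le0 (le_trans h2).
Qed.

End LocalToGlobal.

(** * The disc property *)

Section DiscProperty.
Variables (R : realType) (V : normedModType R[i]).
Implicit Types (A : set V) (u : V -> R) (p z w : V) (t : R[i]) (phi : R[i] -> R[i]).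

Lemma disc_in_small A z w : open A -> A z ->
  exists2 d : R, 0 < d & forall r : R, 0 < r < d -> disc_in A z (r%:C%C *: w).
Proof.
move=> oA Az; have [e e0 he] := (nbhs_nrmP z A).1 (open_nbhs_nbhs (conj oA Az)).
have w1 : 0 < nrm w + 1 by rewrite ltr_wpDl // nrm_ge0.
exists (e / (nrm w + 1)); first by rewrite divr_gt0.
move=> r /andP[r0 rd] t t1; apply: he.
rewrite addrC addKr !nrmZ nrm_real gtr0_norm //; move: rd; rewrite ltr_pdivlMr //.
apply: le_lt_trans; rewrite mulrCA ler_wpM2l ?(ltW r0) //.
by rewrite (le_trans (ler_piMl (nrm_ge0 w) t1)) // lerDl.
Qed.

Lemma locally_submean_of_dsub A u : open A ->
  (forall z w, disc_in A z w -> dsub (fun t : R[i] => u (z + t *: w))) ->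
  locally_submean A u.
Proof.
move=> oA h z w Az; have [d d0 hd] := disc_in_small w oA Az; exists d => // r rd.
have -> : (fun t : R[i] => u (z + (r%:C%C * t) *: w)) =
    (fun t : R[i] => u (z + t *: (r%:C%C *: w))).
  by apply/funext => t; rewrite scalerA [t * _]mulrC.
by apply: h; exact: hd.
Qed.

Lemma plane_continuous p w w' :
  continuous (fun q : R[i] * R[i] => p + q.1 *: w + q.2 *: w').
Proof.
move=> q; apply: cvgD.
  exact: (cvg_comp _ _ (@cvg_fst _ _ (nbhs q.1) (nbhs q.2) _) (@line_continuous _ _ p w q.1)).
exact: (cvg_comp _ _ (@cvg_snd _ _ (nbhs q.1) (nbhs q.2) _) (@scalel_continuous _ _ w' q.2)).
Qed.

(** Pull back to the parameter plane of [w] and [w'], where the tangent direction (1, c) corresponds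
    to [w + c *: w']. *)
Lemma disc_max_principle A u p w w' phi : open A ->
  (forall z, A z -> {for z, continuous u}) -> locally_submean A u ->
  (forall t, nrm t <= 1 -> jet phi t) ->
  (forall t, nrm t <= 1 -> A (p + t *: w + phi t *: w')) ->
  exists2 t0 : R[i], nrm t0 = 1 & forall t, nrm t <= 1 ->
    u (p + t *: w + phi t *: w') <= u (p + t0 *: w + phi t0 *: w').
Proof.
move=> oA cu su jphi Aphi.
apply: (@jet_max_principle R (fun q : R[i] * R[i] => u (p + q.1 *: w + q.2 *: w'))
  [set q : R[i] * R[i] | A (p + q.1 *: w + q.2 *: w')] phi) => //.
- apply: (@open_comp _ _ (fun q : R[i] * R[i] => p + q.1 *: w + q.2 *: w') A) => // q _.
  exact: plane_continuous.
- move=> q Aq; apply: (@continuous_comp _ _ _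
    (fun q : R[i] * R[i] => p + q.1 *: w + q.2 *: w') u); first exact: plane_continuous.
  exact: cu.
- move=> t x c /= Atx; have [d d0 hd] := su _ (w + c *: w') Atx.
  exists d => // r rd.
  have -> : (fun s : R[i] => u (p + (t + r%:C%C * s) *: w + (x + c * (r%:C%C * s)) *: w')) =
      (fun s : R[i] => u (p + t *: w + x *: w' + (r%:C%C * s) *: (w + c *: w'))).
    apply/funext => s; congr u; rewrite !scalerDl scalerDr scalerA [c * _]mulrC.
    by rewrite !addrA; congr (_ + _); rewrite -!addrA; congr (_ + (_ + _)); rewrite addrC.
  exact: hd.
Qed.

(* A continuity principle (Kontinuitaetssatz) for the discs
   [t |-> p + t w + lambda phi(t) w'], [0 <= lambda <= 1]. *)
Definition disc_property A := forall p w w' phi,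
  (forall t, nrm t <= 1 -> jet phi t) -> disc_in A p w ->
  (forall (t : R[i]) (l : R), nrm t = 1 -> 0 <= l <= 1 ->
     A (p + t *: w + (l%:C%C * phi t) *: w')) ->
  forall t, nrm t <= 1 -> A (p + t *: w + phi t *: w').

Lemma disc_property0 : disc_property set0.
Proof. by move=> p w w' phi _ /(_ 0); rewrite nrm0 => /(_ ler01). Qed.

Lemma disc_propertyI A B : disc_property A -> disc_property B -> disc_property (A `&` B).
Proof.
move=> dA dB p w w' phi jphi pw h t t1; split.
  by apply: (dA p w w' phi) => // [s s1|s l s1 l1]; [case: (pw s s1)|case: (h s l s1 l1)].
by apply: (dB p w w' phi) => // [s s1|s l s1 l1]; [case: (pw s s1)|case: (h s l s1 l1)].
Qed.

(** The disc lies in [A] by the disc property, and the maximum principle bounds [u] on it by a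
    boundary value, which is below [c] by the case [l = 1] of the homotopy. *)
Lemma disc_property_sublevel A u (c : R) : open A -> (forall z, A z -> {for z, continuous u}) ->
  locally_submean A u -> disc_property A -> disc_property (A `&` [set z | u z < c]).
Proof.
move=> oA cu su dA p w w' phi jphi pw h.
have Aphi t : nrm t <= 1 -> A (p + t *: w + phi t *: w').
  by apply: dA => // [s s1|s l s1 l1]; [case: (pw s s1)|case: (h s l s1 l1)].
have [t0 t01 ut0] := disc_max_principle oA cu su jphi Aphi.
move=> t t1; split; first exact: Aphi.
rewrite /= (le_lt_trans (ut0 t t1)) //; have [|_] := h t0 1 t01; first by rewrite ler01 lexx.
by rewrite mul1r.
Qed.

Lemma homotopy_continuous p w w' phi t (l : R) : {for t, continuous phi} ->
  {for (t, l), continuous (fun q : R[i] * R => p + q.1 *: w + (q.2%:C%C * phi q.1) *: w')}.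
Proof.
move=> cphi.
have c1 : (q.1 : R[i]) @[q --> (t, l)] --> t by exact: cvg_fst.
have c2 : (q.2%:C%C * phi q.1 : R[i]) @[q --> (t, l)] --> l%:C%C * phi t.
  apply: cvgM; last exact: (cvg_comp _ _ c1 cphi).
  exact: (cvg_comp _ _ (@cvg_snd _ _ (nbhs t) (nbhs l) _) (@real_complex_continuous R l)).
apply: (@continuous_comp _ _ _ (fun q : R[i] * R => (q.1, q.2%:C%C * phi q.1))
  (fun q : R[i] * R[i] => p + q.1 *: w + q.2 *: w')); last exact: plane_continuous.
exact: (cvg_pair c1 c2).
Qed.

(** The flat disc and the homotopy of its boundary are compact, so a single [D j] contains both. *)
Lemma disc_property_bigcup (D : nat -> set V) : (forall j, open (D j)) ->
  (forall i j, (i <= j)%N -> D i `<=` D j) -> (forall j, disc_property (D j)) ->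
  disc_property (\bigcup_j D j).
Proof.
move=> oD incD dD p w w' phi jphi pw h t t1.
have n1 : \forall j \near \oo, forall t, [set t : R[i] | nrm t <= 1] t -> D j (p + t *: w).
  apply: compact_near_forall; first exact: compact_disc.
  move=> s s1; have [i _ Di] := pw s s1.
  exists [set s : R[i] | D i (p + s *: w)].
    by apply: (@line_continuous _ _ p w s); exact: (open_nbhs_nbhs (conj (oD i) Di)).
  exists [set j | (i <= j)%N]; first exact: nbhs_infty_ge.
  by move=> y j /= Dy ij; exact: incD Dy.
have n2 : \forall j \near \oo, forall q : R[i] * R,
    ([set t | nrm t = 1] `*` `[0, 1]%classic) q ->
    D j (p + q.1 *: w + (q.2%:C%C * phi q.1) *: w').
  apply: compact_near_forall.
    by apply: compact_setX; [exact: compact_circle|exact: segment_compact].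
  move=> [s l] [/= s1]; rewrite in_itv /= => l1; have [i _ Di] := h s l s1 l1.
  exists [set q : R[i] * R | D i (p + q.1 *: w + (q.2%:C%C * phi q.1) *: w')].
    have cs : {for s, continuous phi} by apply/jet_continuous/jphi; rewrite s1.
    exact: (@homotopy_continuous p w w' phi s l cs (D i) (open_nbhs_nbhs (conj (oD i) Di))).
  exists [set j | (i <= j)%N]; first exact: nbhs_infty_ge.
  by move=> y j /= Dy ij; exact: incD Dy.
have [j [h1 h2]] := filter_ex (filterI n1 n2).
exists j => //; apply: (dD j p w w' phi) => // s l s1 l1.
by apply: (h2 (s, l)); split; rewrite //= in_itv.
Qed.

(** The distance to [z] is submean by the triangle inequality, since the roots of unity sum to 0;
    the maximum principle follows for any norm. *)
Lemma disc_property_ball z (rho : R) : disc_property [set y | nrm (y - z) < rho].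
Proof.
move=> p w w' phi jphi pw h t t1.
have cn y : {for y, continuous (fun y => nrm (y - z))}.
  apply: (@continuous_comp _ _ _ (fun y => y - z) (@nrm R V)); last exact: nrm_continuous.
  by apply: cvgB; [exact: cvg_id|exact: cvg_cst].
have [|||||t0 t01 ut0] := @disc_max_principle setT (fun y => nrm (y - z)) p w w' phi.
- exact: openT.
- by move=> y _; exact: cn.
- move=> y v _; exists 1 => // r _ e e0; near=> N.
  have N1 : (1 < N)%N by near: N; exact: nbhs_infty_gt.
  have N0 : (0 : R) < N%:R by rewrite ltr0n ltnW.
  rewrite mulr0 scale0r addr0 -[leLHS]addr0 lerD ?(ltW e0) //.
  rewrite ler_pdivlMl //.
  have -> : N%:R * nrm (y - z) =
      nrm (\sum_(m < N) (y + (r%:C%C * omega R N ^+ m) *: v - z)).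
    under eq_bigr do rewrite addrAC.
    rewrite big_split /= sumr_const card_ord -scaler_suml -mulr_sumr.
    have -> : \sum_(m < N) omega R N ^+ m = 0.
      by rewrite -[RHS](@sum_omegaX R N 1) ?N1 //; apply: eq_bigr => m _; rewrite muln1.
    rewrite mulr0 scale0r addr0 -[(y - z) *+ N]scaler_nat nrmZ.
    by rewrite -(rmorph_nat (real_complex R)) nrm_real ger0_norm // ltW.
  exact: nrm_sum.
- exact: jphi.
- by [].
rewrite /= (le_lt_trans (ut0 t t1)) //.
by have := h t0 1 t01; rewrite ler01 lexx mul1r => /(_ isT).
Unshelve. all: by end_near. Qed.

(** Continuity method: the parameters l whose whole disc lies in [A] include 0, form an open set by
    the tube lemma, and form a closed set because all these discs stay in one sublevel set whose
    closure lies in [A]. *)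
Lemma disc_property_exhaustion A u : open A -> (forall z, A z -> {for z, continuous u}) ->
  locally_submean A u -> (forall c, closure [set z | A z /\ u z < c] `<=` A) ->
  disc_property A.
Proof.
move=> oA cu su exh p w w' phi jphi pw h.
pose f (q : R[i] * R) := p + q.1 *: w + (q.2%:C%C * phi q.1) *: w'.
have cf q : nrm q.1 <= 1 -> {for q, continuous f}.
  by case: q => s l /= s1; apply: homotopy_continuous; exact/jet_continuous/jphi.
pose K := [set t : R[i] | nrm t = 1] `*` `[0 : R, 1]%classic.
have [|||q0 _ maxq] := @compact_EVT_max _ _ (u \o f) K.
- by exists (1, 0); split; rewrite /= ?nrm1 // in_itv /= lexx ler01.
- by apply: compact_setX; [exact: compact_circle|exact: segment_compact].
- apply: continuous_in_subspaceT => -[s l] /set_mem[/= s1]; rewrite in_itv /= => l1.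
  apply: continuous_comp; first by apply: cf; rewrite /= s1.
  by apply: cu; exact: h.
have {}maxq s l : nrm s = 1 -> 0 <= l <= 1 -> u (f (s, l)) <= u (f q0).
  by move=> s1 l1; apply: (maxq (s, l)); apply/mem_set; split; rewrite //= in_itv.
(* The maximum of [u] on the boundary homotopy bounds [u] on every disc inside [A]; the added 1
   makes the inequality strict. *)
pose S := [set z | A z /\ u z < u (f q0) + 1].
have SA : closure S `<=` A by exact: exh.
have discS l : 0 <= l <= 1 -> (forall t, nrm t <= 1 -> A (f (t, l))) ->
    forall t, nrm t <= 1 -> S (f (t, l)).
  move=> l1 Al t t1; split; first exact: Al.
  have jl s : nrm s <= 1 -> jet (fun s => l%:C%C * phi s) s.
    by move=> s1; apply: jetM; [exact: jet_cst|exact: jphi].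
  have [t0 t01 ut0] := @disc_max_principle A u p w w' (fun s => l%:C%C * phi s) oA cu su jl Al.
  by rewrite (le_lt_trans (ut0 t t1)) // (le_lt_trans (maxq _ _ t01 l1)) // ltrDl.
pose B := [set l : R | (0 <= l <= 1) /\ forall t, nrm t <= 1 -> A (f (t, l))].
have BE : B = `[0, 1]%classic.
  apply: (@segment_connected R 0 1).
  - exists 0; split; first by rewrite lexx ler01.
    by move=> s s1; rewrite /f /= mul0r scale0r addr0; exact: pw.
  - exists [set l | forall t, nrm t <= 1 -> A (f (t, l))].
      rewrite openE => l Al; rewrite /interior.
      apply: (@compact_near_forall _ [set t : R[i] | nrm t <= 1] _ (nbhs l) _
        (fun l t => A (f (t, l)))); first exact: compact_disc.
      move=> t t1.
      have /(cf (t, l) t1) [[P Q] [/= nP nQ] PQ] : nbhs (f (t, l)) A.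
        by apply: open_nbhs_nbhs; split => //; exact: Al.
      by exists P => //; exists Q => // y i Py Qi; exact: (PQ (y, i)).
    by apply/seteqP; split => l; rewrite /B /= in_itv.
  - exists (\bigcap_(t in [set t : R[i] | nrm t <= 1]) [set l | closure S (f (t, l))]).
      apply: closed_bigI => t t1.
      apply: (@closed_comp _ _ (fun l => f (t, l)) (closure S)); last exact: closed_closure.
      move=> l _; apply: (@continuous_comp _ _ _ (fun l => (t, l)) f).
        exact: (cvg_pair (@cvg_cst _ t _ (nbhs l) _) (@cvg_id _ (nbhs l))).
      exact: cf.
    apply/seteqP; split => l; rewrite /B /= in_itv /=.
      by move=> [l1 Al]; split => // t t1; exact/subset_closure/discS.
    by move=> [l1 Al]; split => // t t1; apply: SA; exact: Al.
move=> t t1; have [_ /(_ t t1)] : B 1 by rewrite BE /= in_itv /= ler01 lexx.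
by rewrite /f /= mul1r.
Qed.

End DiscProperty.

(** * Pseudoconvexity and the distance to the complement *)

Section PshDsub.
Variables (R : realType) (n : nat).
Local Notation V := 'rV[R[i]]_n.
Implicit Types (A : set V) (u : V -> R) (z w : V).

Lemma continuous_psh_continuous A u : open A -> continuous_psh A u ->
  forall z, A z -> {for z, continuous u}.
Proof. by move=> oA [+ _] z Az; rewrite continuous_open_subspace //; apply; exact: mem_set. Qed.

Lemma circle_continuous A u z w : (forall z, A z -> {for z, continuous u}) ->
  disc_in A z w -> continuous ((fun t : R[i] => u (z + t *: w)) \o @cis R).
Proof.
move=> cu zw t; apply: (@continuous_comp _ _ _ (@cis R) (fun t : R[i] => u (z + t *: w))).
  exact: cis_continuous.
apply: (@continuous_comp _ _ _ (fun t : R[i] => z + t *: w) u); first exact: line_continuous.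
by apply: cu; apply: zw; rewrite nrm_cis.
Qed.

Lemma continuous_psh_dsub A u : open A -> continuous_psh A u ->
  forall z w, disc_in A z w -> dsub (fun t : R[i] => u (z + t *: w)).
Proof.
move=> oA pu z w zw; have cu := continuous_psh_continuous oA pu.
have Az : A z by have := zw 0; rewrite nrm0 scale0r addr0 => /(_ ler01).
case: pu => _ [_ _ /(_ z w Az) [_ _ /(_ 0 1 ltr01)]].
have uE t : (EFin \o u) (z + (0 + 1%:C%C * cis t) *: w) = (u (z + cis t *: w))%:E.
  by rewrite /= add0r mul1r.
have [I IE hI] := @circle_mean_dmean R (fun t => (EFin \o u) (z + t *: w))
  (fun t => u (z + t *: w)) 0 1 uE (circle_continuous cu zw).
have sub : [set y : R[i] | `|y - 0| <= (1%:C)%C] `<=` [set t | A (z + t *: w)].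
  by move=> t /=; rewrite subr0 nrmE lecR; exact: zw.
move=> /(_ sub); rewrite IE /= lee_fin scale0r addr0 => uI e e0.
apply: filterS (hI e e0) => N; rewrite ler_norml => /andP[_ h].
by rewrite scale0r addr0 (le_trans uI) // -lerBlDl.
Qed.

Lemma continuous_psh_submean A u : open A -> continuous_psh A u -> locally_submean A u.
Proof. by move=> oA pu; apply: locally_submean_of_dsub => //; exact: continuous_psh_dsub. Qed.

(** Plurisubharmonicity concerns every closed disc in [A], the assumption only small ones;
    [locally_submean_dsub] closes the gap once the disc is rescaled to radius 1. *)
Lemma continuous_psh_of_submean A u : open A -> (forall z, A z -> {for z, continuous u}) ->
  locally_submean A u -> continuous_psh A u.
Proof.
move=> oA cu su; have du := locally_submean_dsub oA cu su.
have usc z : A z -> forall a : R, ((u z)%:E < a%:E)%E -> \forall y \near nbhs z, u y < a.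
  by move=> Az a; rewrite lte_fin => h; exact: (cvgr_lt (u z) (cu z Az)).
split; first by rewrite continuous_open_subspace // => z /set_mem; exact: cu.
split=> [z _|z Az a ha|z w Az]; first exact: ltry.
  apply: (@filterS _ _ (nbhs_filter z) _ _ _ (usc z Az a ha)) => y h _.
  by rewrite /= lte_fin.
split=> [t _|t /= At a ha|a r r0 sub]; first exact: ltry.
  have h : \forall s \near nbhs t, u (z + s *: w) < a.
    exact: (@line_continuous _ _ z w t _ (usc _ At a ha)).
  apply: (@filterS _ _ (nbhs_filter t) _ _ _ h) => s hs _.
  by rewrite /= lte_fin.
have zw' : disc_in A (z + a *: w) (r%:C%C *: w).
  move=> t t1; rewrite scalerA -addrA -scalerDl; apply: sub => /=.
  by rewrite addrC addKr nrmE lecR nrmM nrm_real gtr0_norm // ger_pMl.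
have uE t : (EFin \o u) (z + (a + r%:C%C * cis t) *: w) =
    (u (z + a *: w + cis t *: (r%:C%C *: w)))%:E.
  by rewrite /= scalerDl addrA [_ * cis t]mulrC scalerA.
have [I IE hI] := @circle_mean_dmean R (fun t => (EFin \o u) (z + t *: w))
  (fun t => u (z + a *: w + t *: (r%:C%C *: w))) a r uE (circle_continuous cu zw').
rewrite IE /= lee_fin; apply/ler_addgt0Pr => e e0.
have e2 : 0 < e / 2 by rewrite divr_gt0.
have [N [+]] := filter_ex (filterI (hI _ e2) (du _ _ zw' _ e2)).
by rewrite scale0r addr0 ler_norml; lra.
Qed.

Lemma pseudoconvex_disc_property A : pseudoconvex A -> disc_property A.
Proof.
move=> [oA [u [pu eu]]]; apply: (@disc_property_exhaustion _ _ A u) => //.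
- exact: continuous_psh_continuous.
- exact: continuous_psh_submean.
- by move=> c; case: (eu c).
Qed.

End PshDsub.

(** * The reciprocal distance to the complement *)

Section BoundaryDistance.
Variables (R : realType) (V : normedModType R[i]).
Implicit Types (D E : set V) (x y z w : V).

(** For an empty complement the infimum defaults to 0, whence the non-emptiness assumptions
    below. *)
Definition codist D z : R := inf [set nrm (z - y) | y in ~` D].

Lemma codist_le D z y : ~ D y -> codist D z <= nrm (z - y).
Proof.
move=> Dy; apply: ge_inf; last by exists y.
by exists 0 => _ [x _ <-]; exact: nrm_ge0.
Qed.

Lemma codist_ge D z (m : R) : ~` D !=set0 -> (forall y, ~ D y -> m <= nrm (z - y)) ->
  m <= codist D z.
Proof.
move=> [y Dy] h; apply: lb_le_inf; first by exists (nrm (z - y)), y.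
by move=> _ [x Dx <-]; exact: h.
Qed.

Lemma codist_ge0 D z : ~` D !=set0 -> 0 <= codist D z.
Proof. by move=> D0; apply: codist_ge => // y _; exact: nrm_ge0. Qed.

Lemma lt_codist D z y : nrm (z - y) < codist D z -> D y.
Proof. by move=> h; apply: contrapT => /(codist_le z); rewrite leNgt h. Qed.

Lemma codist_gt0 D z : ~` D !=set0 -> open D -> D z -> 0 < codist D z.
Proof.
move=> D0 oD Dz; have [e e0 he] := (nbhs_nrmP z D).1 (open_nbhs_nbhs (conj oD Dz)).
rewrite (lt_le_trans e0) //; apply: codist_ge => // y Dy.
by rewrite leNgt; apply/negP; rewrite nrmBC => /he.
Qed.

Lemma codist_lipschitz D z x : ~` D !=set0 -> codist D z - codist D x <= nrm (z - x).
Proof.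
move=> D0; rewrite lerBlDl -lerBlDr; apply: codist_ge => // y Dy.
by rewrite lerBlDl addrC [leRHS]addrC (le_trans (codist_le z Dy)) // nrm_triangle.
Qed.

Lemma codist_continuous D : ~` D !=set0 -> continuous (codist D).
Proof.
move=> D0 z; apply/(@cvgrPdist_lt _ _ _ _ (nbhs_filter z)) => e e0.
apply/nbhs_nrmP; exists e => // y yz; rewrite (le_lt_trans _ yz) //.
rewrite ler_norml lerNl opprB codist_lipschitz //=.
by rewrite nrmBC codist_lipschitz.
Qed.

Lemma inv_codist_continuous D z : ~` D !=set0 -> open D -> D z ->
  {for z, continuous (fun z => (codist D z)^-1)}.
Proof.
move=> D0 oD Dz; apply: cvgV; last exact: codist_continuous.
by rewrite gt_eqF // codist_gt0.
Qed.

(* If [f] is holomorphic with [1 / codist <= Re f] on the circle, the discs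
   [z + t w + f(t)^-1 w'] with [|w'| < 1] have their boundaries in [D]. *)
Lemma disc_property_inv_codist D : ~` D !=set0 -> open D -> disc_property D ->
  forall z w, disc_in D z w -> dsub (fun t : R[i] => (codist D (z + t *: w))^-1).
Proof.
move=> D0 oD dD z w zw; apply: dsub_of_jet_majorants => [t t1|f jf f0 gf].
  apply: (@continuous_comp _ _ _ (fun t : R[i] => z + t *: w) (fun x => (codist D x)^-1)).
    exact: line_continuous.
  by apply: inv_codist_continuous => //; apply: zw; rewrite t1.
have fpos t : nrm t = 1 -> 0 < Re (f t).
  move=> t1; rewrite (lt_le_trans _ (gf t t1)) // invr_gt0 codist_gt0 //.
  by apply: zw; rewrite t1.
have fpos' := Re_gt0_in_disc (fun t _ => jf t) fpos.
have fn0 t : nrm t <= 1 -> f t != 0.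
  by move=> /fpos'; apply: contraTneq => ->; rewrite ltxx.
have f00 : 0 < Re (f 0) by apply: fpos'; rewrite nrm0.
have fE : f 0 = (Re (f 0))%:C%C by case: (f 0) f0 => a b /= ->.
rewrite scale0r addr0 -[leRHS]invrK lef_pV2 ?posrE ?invr_gt0 //; last first.
  by apply: codist_gt0 => //; have := zw 0; rewrite nrm0 scale0r addr0; exact.
apply: codist_ge => // y Dy; rewrite leNgt; apply/negP => zy; apply: Dy.
(* Chosen so that [y] is the centre (t = 0) of the disc [z + t w + f(t)^-1 w']; the disc property
   then puts [y] in [D], a contradiction. *)
pose w' := f 0 *: (y - z).
have w'1 : nrm w' < 1.
  by rewrite nrmZ fE nrm_real gtr0_norm // nrmBC -ltr_pdivlMl // mulr1.
have -> : y = z + 0 *: w + (f 0)^-1 *: w'.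
  rewrite scale0r addr0 scalerA mulVf ?scale1r; first by rewrite addrC subrK.
  by apply: fn0; rewrite nrm0.
apply: (dD z w w' (fun t => (f t)^-1)) => //; last by rewrite nrm0.
  by move=> t t1; apply: jetV; [exact: fn0|exact: jf].
(* On the circle the displacement is shorter than [|f t|^-1], which is at most
   [codist D (z + t *: w)]. *)
move=> t l t1 /andP[l0 l1]; apply: (@lt_codist _ (z + t *: w)).
rewrite opprD addrA subrr sub0r nrmN nrmZ nrmM nrm_real ger0_norm // nrmV.
have ft0 : 0 < nrm (f t).
  by rewrite (lt_le_trans (fpos t t1)) // (le_trans (ler_norm _)) // ler_Re_nrm.
have cpos : 0 < codist D (z + t *: w) by apply: codist_gt0 => //; apply: zw; rewrite t1.
have h1 : (nrm (f t))^-1 <= codist D (z + t *: w).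
  rewrite -[leRHS]invrK lef_pV2 ?posrE ?invr_gt0 // (le_trans (gf t t1)) //.
  by rewrite (le_trans (ler_norm _)) // ler_Re_nrm.
apply: lt_le_trans h1.
have i0 : 0 < (nrm (f t))^-1 by rewrite invr_gt0.
rewrite mulrAC -[ltRHS]mul1r ltr_pM2r // (le_lt_trans _ w'1) //.
by apply: ler_piMl => //; exact: nrm_ge0.
Qed.

End BoundaryDistance.

(** * Local disc property implies pseudoconvexity *)

Section LocalDiscProperty.
Variables (R : realType) (n : nat).
Local Notation V := 'rV[R[i]]_n.
Implicit Types (A E : set V) (u : V -> R) (z w : V).

Lemma closure_sub_closed (T : topologicalType) (A B : set T) :
  closed B -> A `<=` B -> closure A `<=` B.
Proof. by move=> cB AB; rewrite closureE; exact: smallest_sub. Qed.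

Lemma open_nrm_ball z (rho : R) : open [set y | nrm (y - z) < rho].
Proof.
rewrite openE => y /= yz; apply/nbhs_nrmP; exists (rho - nrm (y - z)); first by rewrite subr_gt0.
by move=> x xy /=; have := nrm_triangle x y z; lra.
Qed.

Lemma dsub_eq_disc (g h : R[i] -> R) : (forall t, nrm t <= 1 -> g t = h t) ->
  dsub g -> dsub h.
Proof.
move=> gh sg e e0; apply: filterS (sg e e0) => N.
rewrite gh ?nrm0 // => /le_trans -> //; rewrite lerD2r; apply: ler_dmean => t t1.
by rewrite gh ?t1.
Qed.

(** Where [g 0 <= c] the constant alone supplies the inequality, so the maximum is submean even at
    points where nothing is known about [g]. *)
Lemma dsub_maxr (g : R[i] -> R) (c : R) : g 0 <= c \/ dsub g ->
  dsub (fun t => Num.max (g t) c).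
Proof.
move=> gc e e0.
have hc : \forall N \near \oo, c <= dmean N (fun t => Num.max (g t) c) + e.
  near=> N; have N0 : (0 < N)%N by near: N; exact: nbhs_infty_gt.
  rewrite -[leLHS]addr0 lerD ?(ltW e0) // -[leLHS](dmean_cst c N0).
  by apply: ler_dmean => t _; rewrite le_max lexx orbT.
case: gc => [gc|/(_ e e0) sg]; first by rewrite max_r.
apply: filterS2 hc sg => N hc sg; rewrite ge_max hc andbT (le_trans sg) // lerD2r.
by apply: ler_dmean => t _; rewrite le_max lexx.
Unshelve. all: by end_near. Qed.

(** Points outside [A] are farther from [z] than [zeta], which already lies outside [E], so they do
    not affect the infimum. *)
Lemma codist_inter A E z (zeta : V) (rho : R) : ~ E zeta ->
  (forall y, nrm (y - zeta) < 2 * rho -> A y) -> nrm (z - zeta) < rho ->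
  codist (A `&` E) z = codist E z.
Proof.
move=> Ezeta hA zr; have E0 : ~` E !=set0 by exists zeta.
apply/eqP; rewrite eq_le; apply/andP; split.
  by apply: codist_ge => // y Ey; apply: codist_le => -[_ /Ey].
apply: codist_ge => [|y /not_andP[Ay|Ey]]; last exact: codist_le.
  by exists zeta => -[_ /Ezeta].
rewrite (le_trans (codist_le z Ezeta)) // leNgt; apply/negP => h; apply: Ay; apply: hA.
by have := nrm_triangle y z zeta; rewrite (nrmBC y z); lra.
Qed.

Lemma inv_codist_submean_near E (zeta : V) (W : set V) : open E -> ~ E zeta ->
  nbhs zeta W -> open (W `&` E) -> disc_property (W `&` E) ->
  exists2 rho : R, 0 < rho & forall z w, nrm (z - zeta) < rho -> E z ->
    exists2 d : R, 0 < d & forall r : R, 0 < r < d ->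
      dsub (fun t : R[i] => (codist E (z + (r%:C%C * t) *: w))^-1).
Proof.
move=> oE Ezeta /nbhs_nrmP[e e0 he] oWE dWE.
pose rho := e / 2; have rho0 : 0 < rho by rewrite divr_gt0.
have hW y : nrm (y - zeta) < 2 * rho -> W y by move=> h; apply: he; rewrite /rho in h *; lra.
exists rho => // z w zr Ez.
have WE0 : ~` (W `&` E) !=set0 by exists zeta => -[_ /Ezeta].
have oB := @open_nrm_ball zeta rho.
have [d d0 hd] := @disc_in_small _ _ ([set y | nrm (y - zeta) < rho] `&` E) z w
  (openI oB oE) (conj zr Ez).
exists d => // r rd; have {}hd := hd r rd.
apply: (@dsub_eq_disc (fun t : R[i] => (codist (W `&` E) (z + t *: (r%:C%C *: w)))^-1)).
  move=> t t1; have [zt _] := hd t t1.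
  by rewrite (codist_inter Ezeta hW zt) scalerA [t * _]mulrC.
apply: (disc_property_inv_codist WE0 oWE dWE) => t t1.
have [zt Et] := hd t t1; split; last exact: Et.
by apply: hW; move: zt => /=; lra.
Qed.

Lemma bounded_set_nrm (E : set V) : bounded_set E -> exists M : R, forall z, E z -> nrm z <= M.
Proof.
move=> /pinfty_ex_gt0[M /posC[r r0 ->] h]; exists r => z Ez.
by have := h z Ez; rewrite /= nrmE lecR.
Qed.

(** The reciprocal distance [g] is submean near the boundary; the rest of [E] lies in a compact
    subset of [E], on which [g] has a bound [C]. Then [max g C] is submean everywhere and blows up
    at the boundary. *)
Lemma pseudoconvex_of_local_disc_property E (M : R) : open E -> ~` E !=set0 ->
  (forall z, E z -> nrm z <= M) ->
  (forall zeta, closure E zeta -> ~ E zeta -> exists W : set V,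
     [/\ nbhs zeta W, open (W `&` E) & disc_property (W `&` E)]) ->
  pseudoconvex E.
Proof.
move=> oE E0 hM locE.
pose g z := (codist E z)^-1.
(* The condition is vacuous outside [E], so [O] can contain boundary points of [E]. *)
pose O := interior [set z | E z -> forall w, exists2 d : R, 0 < d &
  forall r : R, 0 < r < d -> dsub (fun t : R[i] => g (z + (r%:C%C * t) *: w))].
have cg z : E z -> {for z, continuous g} by exact: inv_codist_continuous.
have clM : closure E `<=` [set z | nrm z <= M].
  by apply: closure_sub_closed => //; exact: closed_nrm_le.
have [C hC] : exists C : R, forall z, E z -> ~ O z -> g z <= C.
  pose K := closure E `&` ~` O.
  have KE : K `<=` E.
    move=> z [clz nO]; apply: contrapT => nE; apply: nO.
    have [W [nW oW dW]] := locE z clz nE.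
    have [rho rho0 hrho] := inv_codist_submean_near oE nE nW oW dW.
    by apply/nbhs_nrmP; exists rho => // y yr Ey w; exact: hrho.
  have [K0|/set0P[z0 Kz0]] := eqVneq K set0.
    exists 0 => z Ez nO; have : K z by split => //; exact: subset_closure.
    by rewrite K0.
  have cK : compact K.
    apply: (subclosed_compact _ (@compact_rV_ball R n M)).
      by apply: closedI; [exact: closed_closure|apply: open_closedC; exact: open_interior].
    by move=> z [/clM].
  have [||z1 _ maxz] := @compact_EVT_max _ _ g K _ cK.
  - by exists z0.
  - by apply: continuous_in_subspaceT => z /set_mem /KE; exact: cg.
  exists (g z1) => z Ez nO; apply: maxz; apply/mem_set; split => //.
  exact: subset_closure.
pose u z := Num.max (g z) C.
have cu z : E z -> {for z, continuous u}.
  by move=> Ez; apply: (@continuous_max _ _ g (fun=> C)); [exact: cg|exact: cst_continuous].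
split=> //; exists u; split.
  apply: continuous_psh_of_submean => // z w Ez.
  have [Oz|nO] := pselect (O z).
    have [d d0 hd] := interior_subset Oz Ez w; exists d => // r rd.
    by apply: dsub_maxr; right; exact: hd.
  exists 1 => // r _; apply: dsub_maxr; left.
  by rewrite mulr0 scale0r addr0; exact: hC.
move=> c; pose S := [set z | E z /\ u z < c].
(* A closed condition that holds on the sublevel set and fails wherever [codist E] vanishes, in
   particular outside [E]. *)
have SE : closure S `<=` [set z | 1 <= c * codist E z].
  apply: closure_sub_closed; last first.
    move=> z [Ez uz]; have dz := codist_gt0 E0 oE Ez.
    rewrite /= -ler_pdivrMr // mul1r ltW // (le_lt_trans _ uz) //.
    by rewrite /u le_max lexx.
  apply: (@closed_comp _ _ (fun z => c * codist E z) [set x | 1 <= x]); last exact: closed_ge.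
  by move=> z _; exact: (cvgM (@cst_continuous V R c z) (codist_continuous E0 (x := z))).
split.
  rewrite precompactE; apply: (subclosed_compact _ (@compact_rV_ball R n M)).
    exact: closed_closure.
  apply: closure_sub_closed; first exact: closed_nrm_le.
  by move=> z [Ez _]; exact: hM.
move=> z /SE /= h; apply: contrapT => nE.
have : codist E z = 0.
  apply/eqP; rewrite eq_le codist_ge0 // andbT.
  by rewrite (le_trans (codist_le z nE)) // subrr nrm0.
by move=> d0; move: h; rewrite d0 mulr0 ler10.
Qed.

End LocalDiscProperty.

(** * The blow-up set *)

Section MainProof.
Variables (R : realType) (n : nat).
Local Notation V := 'rV[R[i]]_n.
Implicit Types (z zeta : V) (Omega F U : set V).

Lemma nbhs_euclidean_ball zeta (r : R) : 0 < r -> nbhs zeta (euclidean_ball zeta r).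
Proof.
move=> r0; have n1 : (0 : R) < n%:R + 1 by rewrite ltr_wpDl // ler0n.
(* With x the sup norm of [y - zeta], the squared Euclidean norm is at most [n x^2], and
   [n x^2 <= ((n + 1) x) x < r^2]. *)
apply/nbhs_nrmP; exists (Num.min r (r / (n%:R + 1))).
  by rewrite lt_min r0 divr_gt0.
move=> y; rewrite lt_min => /andP[yr yn]; rewrite /euclidean_ball /=.
have -> : \sum_(i < n) `|y 0 i - zeta 0 i| ^+ 2 =
    (\sum_(i < n) nrm (y 0 i - zeta 0 i) ^+ 2)%:C%C.
  by rewrite rmorph_sum; apply: eq_bigr => i _; rewrite nrmE -rmorphXn.
rewrite -rmorphXn ltcR.
have : \sum_(i < n) nrm (y 0 i - zeta 0 i) ^+ 2 <= n%:R * nrm (y - zeta) ^+ 2.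
  rewrite mulr_natl -[X in _ *+ X](card_ord n) -sumr_const; apply: ler_sum => i _.
  rewrite ler_sqr ?nnegrE ?nrm_ge0 //.
  by have := nrm_coord (y - zeta) i; rewrite !mxE.
move: yn; rewrite ltr_pdivlMr // => yn.
have := nrm_ge0 (y - zeta); have : (0 : R) <= n%:R by rewrite ler0n.
nra.
Qed.

(** Points of [Omega] itself are included because sublevel sets of [v] may have boundary points
    inside [Omega]. *)
Lemma locally_disc_property_off Omega F zeta : open Omega ->
  locally_pseudoconvex_off Omega F -> closure Omega zeta -> ~ F zeta ->
  exists W : set V, [/\ nbhs zeta W, open (W `&` Omega) & disc_property (W `&` Omega)].
Proof.
move=> oO locO clz nF; have [Oz|nO] := pselect (Omega zeta).
  have [e e0 he] := (nbhs_nrmP zeta Omega).1 (open_nbhs_nbhs (conj oO Oz)).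
  exists [set y | nrm (y - zeta) < e].
  have -> : [set y | nrm (y - zeta) < e] `&` Omega = [set y | nrm (y - zeta) < e].
    by apply/setIidl => y; exact: he.
  split; [|exact: open_nrm_ball|exact: disc_property_ball].
  by apply/nbhs_nrmP; exists e.
have [|r r0 pO] := locO zeta.
  by split=> //; split=> // /interior_subset.
exists (euclidean_ball zeta r); split; first exact: nbhs_euclidean_ball.
  by case: pO.
exact: pseudoconvex_disc_property.
Qed.

Lemma disc_property_blowup Omega F U (v : V -> R) (M : R) : open Omega ->
  (forall z, Omega z -> nrm z <= M) ->
  F !=set0 -> F `<=` boundary Omega -> locally_pseudoconvex_off Omega F ->
  pseudoconvex U -> F `<=` U -> continuous_psh (U `&` Omega) v ->
  (forall z, F z -> v y @[y --> within (U `&` Omega) (nbhs z)] --> +oo) ->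
  disc_property (U `&` Omega).
Proof.
move=> oO bO [z0 Fz0] Fb locO pU FU pv vF.
have oU : open U by case: pU.
have oUO : open (U `&` Omega) by exact: openI.
have nF z : F z -> ~ Omega z.
  by move=> /Fb[_ nz] Oz; apply: nz; rewrite /interior; exact: open_nbhs_nbhs.
have cv := continuous_psh_continuous oUO pv.
have sv := continuous_psh_submean oUO pv.
pose D j := (U `&` Omega) `&` [set z | v z < j%:R].
have oD j : open (D j).
  rewrite openE => z [UOz vz]; apply: filterI; first exact: open_nbhs_nbhs.
  exact: (cvgr_lt (v z) (cv z UOz)).
have -> : U `&` Omega = \bigcup_j D j.
  apply/seteqP; split => [z UOz|z [j _ []] //].
  exists (Num.truncn `|v z|).+1 => //; split => //=.
  by rewrite (le_lt_trans (ler_norm _)) // truncnS_gt.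
apply: disc_property_bigcup => // [i j ij z [UOz vz]|j].
  by split=> //=; rewrite (lt_le_trans vz) // ler_nat.
apply: pseudoconvex_disc_property.
apply: (@pseudoconvex_of_local_disc_property _ _ _ M) => //.
- by exists z0 => -[[_ /(nF _ Fz0)]].
- by move=> z [[_ Oz] _]; exact: bO.
move=> zeta clz nD.
have clO : closure Omega zeta by apply: closureS clz => z [[]].
have [Fz|nFz] := pselect (F zeta).
  (* Since [v] tends to infinity at [zeta], this is a neighbourhood of [zeta], and it misses
     [D j]. *)
  exists [set z | (U `&` Omega) z -> j%:R < v z].
  have -> : [set z | (U `&` Omega) z -> j%:R < v z] `&` D j = set0.
    by apply/seteqP; split => // z [h [UOz vz]]; have := h UOz; rewrite ltNge ltW.
  split; [|exact: open0|exact: disc_property0].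
  by have /cvgryPgt /(_ j%:R) := vF zeta Fz.
have [W [nW oW dW]] := locally_disc_property_off oO locO clO nFz.
(* Away from [F], [D j] is locally a sublevel set of [v] in an intersection of two sets with the
   disc property. *)
have E : W `&` D j = (U `&` (W `&` Omega)) `&` [set z | v z < j%:R].
  by rewrite /D !setIA [W `&` U]setIC.
have oUW : open (U `&` (W `&` Omega)) by exact: openI.
have UWsub : U `&` (W `&` Omega) `<=` U `&` Omega by move=> z [? []].
exists W; split => //; rewrite E.
  rewrite openE => z [UOz vz]; apply: filterI; first exact: open_nbhs_nbhs.
  exact: (cvgr_lt (v z) (cv z (UWsub z UOz))).
apply: disc_property_sublevel => //.
- by move=> z /UWsub; exact: cv.
- by move=> z w /UWsub; exact: sv.
- by apply: disc_propertyI => //; exact: pseudoconvex_disc_property.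
Qed.

End MainProof.

Theorem proposition2p3 (R : realType) (n : nat) (Omega F : set 'rV[R[i]]_n)
  (Omega_domain : is_domain Omega) (Omega_bounded : bounded_set Omega)
  (F_sub : F `<=` boundary Omega) (F_neq0 : F !=set0) (F_closed : closed F)
  (locally_psc : locally_pseudoconvex_off Omega F)
  (psh_blowup : exists (U : set 'rV[R[i]]_n) (v : 'rV[R[i]]_n -> R),
    [/\ pseudoconvex U, F `<=` U, continuous_psh (U `&` Omega) v
      & F = [set z | boundary Omega z /\
                     tends_to_pinfty_along (U `&` Omega) v z]]) :
  pseudoconvex Omega.
Proof.
have [oO _ _] := Omega_domain.
have [U [v [pU FU pv FE]]] := psh_blowup.
have oU : open U by case: pU.
have blow z : F z -> v y @[y --> within (U `&` Omega) (nbhs z)] --> +oo.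
  by rewrite FE => -[_ []].
have [M bO] := bounded_set_nrm Omega_bounded.
have dUO := disc_property_blowup oO bO F_neq0 F_sub locally_psc pU FU pv blow.
apply: (@pseudoconvex_of_local_disc_property _ _ _ M) => // [|zeta clz nz].
  case: F_neq0 => z Fz; exists z => Oz; have [_] := F_sub z Fz; apply.
  by rewrite /interior; exact: open_nbhs_nbhs.
(* At points of [F] the neighbourhood is [U] itself; elsewhere local pseudoconvexity supplies
   one. *)
have [Fz|nFz] := pselect (F zeta); last exact: (locally_disc_property_off oO locally_psc).
exists U; split => //; last exact: openI.
by apply: open_nbhs_nbhs; split => //; exact: FU.
Qed.
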